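(* Let $K$ be a field of characteristic $p$, let $U$ be a coherent good set of valuations on $K$, and let $K_0\subseteq K$ be the field of constants of $U$. Let $\phi:A\to K\{\tau\}$ be a Drinfeld module of positive relative modular transcendence degree over $K_0$. Then there exists a constant $C>0$ depending only on $\phi$ and $K$ such that $\hat h(x)>C$ for every non-torsion point $x$ of the perfect closure $K^{\mathrm{per}}$ of $K$.
   Context: Setting: $p$ prime, $q$ a power of $p$, $A$ the ring of functions on a nonsingular projective curve over $\mathbb{F}_q$ regular away from a fixed closed point; $K\supseteq\mathbb{F}_q$. $K\{\tau\}$ twisted polynomials with $\tau(x)=x^q$. A Drinfeld module $\phi:A\to K\{\tau\}$ is a ring morphism with $\tau^0$-coefficient of $\phi_a$ equal to $i(a)$ (fixed $i:A\to K$), not all $\phi_a$ of degree $0$ in $\tau$. $\deg(\phi_a)$ is the degree of $\phi_a$ as a polynomial in $x$. Torsion: $\phi_a(x)=0$ for some nonzero $a$. Field of definition: smallest field containing all coefficients of all $\phi_a$; $\phi^{(\gamma)}_a=\gamma^{-1}\phi_a\gamma$; relative modular transcendence degree over $K_0$: minimum over $\gamma\in K^{\mathrm{alg}}\setminus\{0\}$ of the transcendence degree over $K_0$ of the compositum of $K_0$ and the field of definition of $\phi^{(\gamma)}$. Valuations are discrete, normalized with value group $\mathbb{Z}$. Good set of valuations: set $U$ with degrees $d:U\to\mathbb{R}_{>0}$, each nonzero $x$ has $v(x)\ne0$ for finitely many $v$, and $\sum_{v\in U}d(v)v(x)=0$; field of constants $\{0\}\cup\{x:v(x)=0\,\forall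 v\in U\}$. $v$ is coherent if $\sum_{w|v}e(w|v)f(w|v)=[L:K]$ for all finite $L/K$, extensions getting degree $d(w)=f(w|v)d(v)/[L:K]$; $U$ is coherent if all its valuations are coherent and for every finite $L/K$ the set $U_L$ of extensions is a good set on $L$. Heights: for finite $L/K$, $w\in U_L$, $y\in L$: $\hat h_w(y)=-d(w)\lim_n\min\{0,w(\phi_{a^n}(y))\}/\deg(\phi_{a^n})$ ($a\in A$ non-constant); $\hat h(y)=\sum_{w\in U_L}\hat h_w(y)$, independent of $L$. *)

(* Defs.v *)
From HB Require Import structures.
From mathcomp Require Import all_boot all_order all_algebra all_field.
From mathcomp Require Import all_classical all_reals all_analysis.
From mathcomp Require Import (canonicals) mpoly.

Set Implicit Arguments.
Unset Strict Implicit.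
Unset Printing Implicit Defensive.

Import Order.TTheory GRing.Theory Num.Theory.
Import numFieldNormedType.Exports.

Local Open Scope classical_set_scope.
Local Open Scope ring_scope.

(** * Generated subfields and transcendence degree *)

Definition is_subfield (E : fieldType) (S : set E) : Prop :=
  [/\ S 1, forall x y, S x -> S y -> S (x - y)
         & forall x y, S x -> S y -> S (x / y)].

Definition gen_field (E : fieldType) (S : set E) : set E :=
  smallest (@is_subfield E) S.

Definition alg_independent (E : fieldType) (k : set E) (n : nat)
    (x : 'I_n -> E) : Prop :=
  forall P : mpoly.mpoly n E,
    (forall m, k (mpoly.mcoeff m P)) -> mpoly.meval x P = 0 -> P = 0.

(* Transcendence degree of the field S over its subfield k, with value +oo
   when S contains arbitrarily large algebraically independent families. *)
Definition trdeg (R : realType) (E : fieldType) (k S : set E) : \bar R :=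
  ereal_sup [set n%:R%:E | n in
    [set n | exists x : 'I_n -> E, (forall i, S (x i)) /\ alg_independent k x]].

(** * Discrete valuations *)

(* The value group is exactly Z since some element has value 1. *)
Definition is_valuation (K : fieldType) (v : K -> \bar int) : Prop :=
  [/\ forall x, v x != -oo%E,
      forall x, v x = +oo%E <-> x = 0,
      forall x y, v (x * y) = (v x + v y)%E,
      forall x y, (Order.min (v x) (v y) <= v (x + y)%R)%E
    & exists x, v x = 1%E].

(* Real value of a finite valuation; an infinite value is sent to 0. *)
Definition val_real (R : realType) (z : \bar int) : R := (fine z)%:~R.

Definition good_set (R : realType) (K : fieldType) (U : set (K -> \bar int))
    (d : (K -> \bar int) -> R) : Prop :=
  [/\ forall v, U v -> is_valuation v,
      forall v, U v -> 0 < d v,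
      forall x, x != 0 -> finite_set [set v | U v /\ v x != 0%E]
    & forall x, x != 0 -> \sum_(v \in U) d v * val_real R (v x) = 0].

Definition constants (K : fieldType) (U : set (K -> \bar int)) : set K :=
  [set x | x = 0 \/ forall v, U v -> v x = 0%E].

Section Extensions.
Variables (K : fieldType) (L : fieldExtType K).
Implicit Types (v : K -> \bar int) (w : L -> \bar int).

Definition is_ramification_index w v (e : nat) : Prop :=
  (0 < e)%N /\ forall c : K, w c%:A = (e%:Z%:E * v c)%E.

Definition extends w v : Prop :=
  is_valuation w /\ exists e, is_ramification_index w v e.

Definition ramification_index w v : nat :=
  xget 0%N [set e | is_ramification_index w v e].

(* The classes of b_0, ..., b_(n-1) form a basis of the residue field of w
   over the residue field of v. *)
Definition residue_basis w v (n : nat) (b : 'I_n -> L) : Prop :=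
  [/\ forall i, (0 <= w (b i))%E,
      forall c : 'I_n -> K, (forall i, (0 <= v (c i))%E) ->
        (0 < w (\sum_i c i *: b i)%R)%E -> forall i, (0 < v (c i))%E
    & forall y, (0 <= w y)%E -> exists c : 'I_n -> K,
        (forall i, (0 <= v (c i))%E) /\ (0 < w (y - \sum_i c i *: b i)%R)%E].

Definition residue_degree w v : nat :=
  xget 0%N [set n | exists b : 'I_n -> L, residue_basis w v b].

(* The normalized valuation of K lying below w, unique when it exists. *)
Definition val_below w : K -> \bar int :=
  xget (fun=> 0%E) [set v | is_valuation v /\ extends w v].

Definition ext_set (U : set (K -> \bar int)) : set (L -> \bar int) :=
  [set w | exists2 v, U v & extends w v].

Definition ext_deg (R : realType) (d : (K -> \bar int) -> R)
    (w : L -> \bar int) : R :=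
  (residue_degree w (val_below w))%:R * d (val_below w) / (\dim {:L})%:R.

End Extensions.

Definition coherent_val (K : fieldType) (v : K -> \bar int) : Prop :=
  forall L : fieldExtType K,
    (\sum_(w \in [set w : L -> \bar int | extends w v])
       ramification_index w v * residue_degree w v)%N = \dim {:L}.

Definition coherent (R : realType) (K : fieldType) (U : set (K -> \bar int))
    (d : (K -> \bar int) -> R) : Prop :=
  (forall v, U v -> coherent_val v) /\
  (forall L : fieldExtType K, good_set (@ext_set K L U) (@ext_deg K L R d)).

(** * The ring of functions of a curve regular away from a point *)

Section Curve.
Variables (R : realType) (Fq F : fieldType) (iF : {rmorphism Fq -> F}).

(* F is a finitely generated extension of Fq of transcendence degree 1. *)
Definition is_function_field : Prop :=
  (exists s : seq F, gen_field (range iF `|` [set` s]) = setT) /\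
  trdeg R (range iF) setT = 1%:E.

(* The closed points of the nonsingular projective curve with function field F
   are the discrete valuations of F that are trivial on Fq. *)
Definition closed_point (v : F -> \bar int) : Prop :=
  is_valuation v /\ forall c, c != 0 -> v (iF c) = 0%E.

Definition regular_away_from (oo : F -> \bar int) : set F :=
  [set f | forall v, closed_point v -> v <> oo -> (0 <= v f)%E].

(* A is the ring of functions regular away from oo, embedded in F by iA. *)
Definition is_function_ring (oo : F -> \bar int) (A : comNzRingType)
    (iA : {rmorphism A -> F}) : Prop :=
  [/\ is_function_field, closed_point oo, injective iA
    & range iA = regular_away_from oo].

(* The constant functions are the elements algebraic over Fq; they need not
   be in Fq when the curve is not geometrically irreducible. *)
Definition nonconstant (A : comNzRingType) (iA : {rmorphism A -> F}) (a : A)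
    : Prop := ~ algebraicOver iF (iA a).

End Curve.

(** * Twisted polynomials *)

(* A twisted polynomial sum_i c_i tau^i is stored as the polynomial with
   coefficients c_i; the product is determined by tau c = (tau c) tau. *)
Definition twpoly (K : fieldType) (tau : {rmorphism K -> K}) : Type :=
  {poly K}.

Section TwistedPoly.
Variables (K : fieldType) (tau : {rmorphism K -> K}).
Implicit Types P Q S : {poly K}.

HB.instance Definition _ := GRing.Zmodule.on (twpoly tau).

Local Notation tauX i := (iter i tau).

Definition twmul P Q : {poly K} :=
  \poly_(n < size P + size Q) \sum_(i < n.+1) P`_i * tauX i Q`_(n - i).

Lemma tauX0 i : tauX i 0 = 0.
Proof. by elim: i => //= i ->; rewrite rmorph0. Qed.
Lemma tauX1 i : tauX i 1 = 1.
Proof. by elim: i => //= i ->; rewrite rmorph1. Qed.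
Lemma tauXD i : {morph tauX i : x y / x + y}.
Proof. by elim: i => [|i IH] x y //; rewrite !iterS IH rmorphD. Qed.
Lemma tauXM i : {morph tauX i : x y / x * y}.
Proof. by elim: i => [|i IH] x y //; rewrite !iterS IH rmorphM. Qed.

Lemma coef_twmul P Q n :
  (twmul P Q)`_n = \sum_(i < n.+1) P`_i * tauX i Q`_(n - i).
Proof.
rewrite coef_poly; case: ltnP => // le_n; rewrite big1 // => i _.
have [leP|ltP] := leqP (size P) i; first by rewrite nth_default ?mul0r.
rewrite [Q`__]nth_default ?tauX0 ?mulr0 //.
by rewrite leq_subRL -1?ltnS //; apply: leq_trans le_n; rewrite leq_add2r ltnW.
Qed.

Lemma coef_twmul_rev P Q n :
  (twmul P Q)`_n = \sum_(i < n.+1) P`_(n - i) * tauX (n - i) Q`_i.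
Proof.
rewrite coef_twmul (reindex_inj rev_ord_inj) /=.
by apply: eq_bigr => i _; rewrite (sub_ordK i).
Qed.

Lemma twmulA : associative twmul.
Proof.
move=> p q r; apply/polyP=> i; rewrite coef_twmul coef_twmul_rev.
pose coef3 j k := p`_j * (tauX j q`_(i - j - k) * tauX (i - k) r`_k).
transitivity (\sum_(j < i.+1) \sum_(k < i.+1 | (k <= i - j)%N) coef3 j k).
  apply: eq_bigr => /= j _; rewrite coef_twmul_rev.
  rewrite (big_morph _ (@tauXD j) (@tauX0 j)) big_distrr /=.
  rewrite (big_ord_narrow_leq (leq_subr _ _)); apply: eq_bigr => k _ /=.
  rewrite tauXM -iterD /coef3; congr (_ * (_ * iter _ _ _)).
  have := ltn_ord j; have := ltn_ord k; rewrite !ltnS => ? ?.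
  by rewrite addnBA // subnKC.
rewrite (exchange_big_dep predT) //=; apply: eq_bigr => k _.
transitivity (\sum_(j < i.+1 | (j <= i - k)%N) coef3 j k).
  apply: eq_bigl => j; rewrite -ltnS -(ltnS j) -!subSn ?leq_ord //.
  by rewrite -subn_gt0 -(subn_gt0 j) -!subnDA addnC.
rewrite (big_ord_narrow_leq (leq_subr _ _)) coef_twmul big_distrl /=.
by apply: eq_bigr => j _; rewrite /coef3 -!subnDA addnC mulrA.
Qed.

Lemma tw1mul : left_id 1%:P twmul.
Proof.
move=> p; apply/polyP => i; rewrite coef_twmul big_ord_recl subn0 /=.
by rewrite big1 => [|j _]; rewrite coefC /= ?mul1r ?mul0r ?addr0.
Qed.

Lemma twmul1 : right_id 1%:P twmul.
Proof.
move=> p; apply/polyP => i; rewrite coef_twmul_rev big_ord_recl subn0 /=.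
by rewrite big1 => [|j _]; rewrite coefC /= ?tauX1 ?tauX0 ?mulr1 ?mulr0 ?addr0.
Qed.

Lemma twmulDl : left_distributive twmul +%R.
Proof.
move=> p q r; apply/polyP=> i; rewrite coefD !coef_twmul -big_split.
by apply: eq_bigr => j _; rewrite coefD mulrDl.
Qed.

Lemma twmulDr : right_distributive twmul +%R.
Proof.
move=> p q r; apply/polyP=> i; rewrite coefD !coef_twmul -big_split.
by apply: eq_bigr => j _; rewrite coefD tauXD mulrDr.
Qed.

Lemma tw1_neq0 : (1%:P : {poly K}) != 0.
Proof. by rewrite polyC_eq0 oner_eq0. Qed.

HB.instance Definition _ := GRing.Zmodule_isNzRing.Build (twpoly tau)
  twmulA tw1mul twmul1 twmulDl twmulDr tw1_neq0.

Definition twcoef (P : twpoly tau) (i : nat) : K := (P : {poly K})`_i.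

Definition twdeg (P : twpoly tau) : nat := (size (P : {poly K})).-1.

(* Value at x : E of P, seen as the polynomial sum_i c_i X^(q^i) over the
   extension j : K -> E. *)
Definition tweval (q : nat) (E : fieldType) (j : K -> E) (P : twpoly tau)
    (x : E) : E :=
  \sum_(i < (twdeg P).+1) j (twcoef P i) * x ^+ (q ^ i).

End TwistedPoly.

(** * Drinfeld modules *)

Section Drinfeld.
Variables (R : realType) (q : nat) (A : comNzRingType) (K : fieldType).
Variables (tau : {rmorphism K -> K}).
Implicit Type phi : {rmorphism A -> twpoly tau}.

Definition is_drinfeld (i : {rmorphism A -> K}) phi : Prop :=
  (forall a, twcoef (phi a) 0 = i a) /\ (exists a, twdeg (phi a) <> 0%N).

Definition torsion phi (E : fieldType) (j : K -> E) (x : E) : Prop :=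
  exists2 a : A, a != 0 & tweval q j (phi a) x = 0.

(* Coefficients of all the gamma^-1 phi_a gamma: since
   tau^n gamma = gamma^(q^n) tau^n, the coefficient of tau^n in
   gamma^-1 (sum_n c_n tau^n) gamma is gamma^-1 c_n gamma^(q^n). *)
Definition conj_coefs phi (E : fieldType) (j : K -> E) (g : E) : set E :=
  [set z | exists a n, z = g^-1 * j (twcoef (phi a) n) * g ^+ (q ^ n)].

Definition field_of_definition phi (E : fieldType) (j : K -> E) (g : E)
    : set E := gen_field (conj_coefs phi j g).

(* E is meant to be an algebraic closure of K. *)
Definition rel_modular_trdeg phi (E : fieldType) (j : K -> E) (K0 : set K)
    : \bar R :=
  ereal_inf [set trdeg R (j @` K0)
                   (gen_field (j @` K0 `|` field_of_definition phi j g))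
            | g in [set g | g != 0]].

(* The degree of phi_(a^n) as a polynomial in x is q ^ twdeg. *)
Definition local_height phi (d : (K -> \bar int) -> R) (a : A)
    (L : fieldExtType K) (w : L -> \bar int) (y : L) : R :=
  - ext_deg d w *
  limn (fun n : nat =>
    val_real R (Order.min 0%E (w (tweval q (in_alg L) (phi (a ^+ n)) y)))
      / (q ^ twdeg (phi (a ^+ n)))%:R).

Definition height phi (U : set (K -> \bar int)) (d : (K -> \bar int) -> R)
    (a : A) (L : fieldExtType K) (y : L) : R :=
  \sum_(w \in @ext_set K L U) local_height phi d a w y.

End Drinfeld.

(** * Algebraic and perfect closures *)

Definition is_alg_closure (K : fieldType) (E : closedFieldType)
    (j : {rmorphism K -> E}) : Prop := forall z : E, algebraicOver j z.

(* The perfect closure of K, of characteristic p, inside an algebraic closure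
   j : K -> E. *)
Definition perfect_closure (p : nat) (K E : fieldType) (j : K -> E) : set E :=
  [set x | exists n : nat, range j (x ^+ (p ^ n))].

(* Main.v *)
(** A point [y] of [K^per] has [y^(p^m) = c] in [K], so each place [v] of [K] has
    a unique extension to [K(y)], with [v(y) = v(c) / p^m], and by coherence the
    height of [y] is the sum over [v] of [d v] times a local height computed in
    [K].

    Fix [t] with [phi_t] of rank [r > 0]. If the height of [x] is tiny, then for
    all [k <= 2n] the points [x_k = phi_(t^k)(x)] have valuations bounded below,
    with bound [0] up to a tiny error at almost all places. The Moore
    determinant of [n] vectors in the [F_p]-span of the [x_k] can be computed
    with the columns [tau^l phi_(t^k)], which after rescaling are monic additive
    polynomials of all degrees [p^j]; this bounds its valuation below by
    [- O(n)] at every place, once the contributions of the leading coefficient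
    of [phi_t] have been cancelled by the product formula.

    Positivity of the relative modular transcendence degree yields a place [v0]
    where a coefficient of the monic conjugate of [phi_t] has negative valuation.
    There one finds [n] independent vectors whose Moore determinant has valuation
    at least [c p^n - O(n)] with [c > 0]. Either all [x_k] have valuation at least
    [-s], [s] small, and truncating [phi_t] at its dominant coefficient gives a
    monic additive polynomial of fixed degree that is small on all of them; or
    the vectors of valuation at least [-s] lie in a hyperplane, and leaving out
    a complementary vector gains [s p^n]. For [n] large this contradicts the
    product formula, because the determinant is nonzero when [x] is not
    torsion. *)

From HB Require Import structures.
Require Import Defs.
From mathcomp Require Import all_boot all_order all_algebra all_field.
From mathcomp Require Import all_classical all_reals all_analysis.
From mathcomp Require Import ring lra zify.
From mathcomp Require Import (canonicals, coercions) mpoly.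

Set Implicit Arguments.
Unset Strict Implicit.
Unset Printing Implicit Defensive.

Import Order.TTheory GRing.Theory Num.Theory.
Import numFieldNormedType.Exports.

Local Open Scope classical_set_scope.
Local Open Scope ring_scope.

(** * Spans over the prime field and Moore determinants *)

Section Moore.
Variables (E : fieldType) (p : nat).
Hypothesis charE : p \in [pchar E].
Implicit Types (s : seq E) (x y z : E).

Let p_prime : prime p := pcharf_prime charE.

Lemma exprDp n x y : (x + y) ^+ (p ^ n) = x ^+ (p ^ n) + y ^+ (p ^ n).
Proof. by rewrite exprDn_pchar // pnatX pnatE ?charE. Qed.

Lemma exprDp1 x y : (x + y) ^+ p = x ^+ p + y ^+ p.
Proof. by rewrite -[p]expn1 exprDp. Qed.

Lemma expr_sum_p n (I : Type) (r : seq I) (P : pred I) (F : I -> E) :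
  (\sum_(i <- r | P i) F i) ^+ (p ^ n) = \sum_(i <- r | P i) F i ^+ (p ^ n).
Proof.
elim/big_rec2: _ => [|i y1 y2 _ <-]; last by rewrite exprDp.
by rewrite expr0n expn_eq0 -leqn0 leqNgt prime_gt0.
Qed.

Lemma natr_expp n c : (c%:R ^+ (p ^ n) : E) = c%:R.
Proof.
elim: n => [|n IHn]; first by rewrite expn0 expr1.
by rewrite expnSr exprM IHn -(pFrobenius_autE charE) pFrobenius_aut_nat.
Qed.

(** The [p] elements of the prime field are distinct roots of the monic polynomial [X^p - X]. *)
Lemma Artin_Schreier_prod x : x ^+ p - x = \prod_(c < p) (x - (c : nat)%:R).
Proof.
pose rs := [seq (c%:R : E) | c <- iota 0 p].
have p_gt1 := prime_gt1 p_prime.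
have sP : size ('X^p - 'X : {poly E}) = p.+1.
  by rewrite size_polyDl ?size_polyXn // size_polyN size_polyX ltnS.
have := @all_roots_prod_XsubC _ ('X^p - 'X : {poly E}) rs.
rewrite size_map size_iota sP => /(_ erefl).
have -> : all (root ('X^p - 'X)) rs.
  apply/allP => _ /mapP [c _ ->].
  by rewrite rootE !hornerE -{1}[p]expn1 natr_expp subrr.
rewrite uniq_rootsE map_inj_in_uniq ?iota_uniq => [|a b]; last first.
  rewrite !mem_iota !add0n /= => lt_ap lt_bp /eqP.
  wlog le_ab : a b lt_ap lt_bp / (a <= b)%N.
    move=> H; case/orP: (leq_total a b) => [|le_ba /eqP e]; first exact: H.
    by apply/esym; apply: H => //; apply/eqP.
  rewrite eq_sym -subr_eq0 -natrB // -(dvdn_pcharf charE).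
  by move=> /dvdn_leq; case: (ltnP a b); lia.
move=> /(_ isT isT); have -> : lead_coef ('X^p - 'X : {poly E}) = 1.
  by rewrite lead_coefDl ?lead_coefXn // size_polyXn size_polyN size_polyX.
rewrite scale1r big_map => /(congr1 (horner^~ x)).
rewrite !hornerE horner_prod => ->.
rewrite -[p in iota 0 p]subn0 -[iota 0 _]/(index_iota 0 p) big_mkord.
by apply: eq_bigr => c _; rewrite !hornerE.
Qed.

Lemma frob_prod x y :
  x ^+ p - y ^+ p.-1 * x = \prod_(c < p) (x - (c : nat)%:R * y).
Proof.
have [->|y0] := eqVneq y 0.
  rewrite expr0n -subn1 subn_eq0 leqNgt prime_gt1 // mul0r subr0.
  under eq_bigr do rewrite mulr0 subr0.
  by rewrite prodr_const card_ord.
have {1 2 3}-> : x = y * (x / y) by rewrite mulrC divfK.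
rewrite exprMn mulrA -exprSr prednK ?prime_gt0 // -mulrBr Artin_Schreier_prod.
rewrite -[p in y ^+ p]card_ord -prodr_const -big_split /=.
by apply: eq_bigr => c _; rewrite mulrBr mulrC divfK // mulrC.
Qed.

(** Coefficients in the prime field are represented by natural numbers; [opp_natr] supplies
    negatives and [natr_inv] inverses. *)
Fixpoint pspan s x : Prop :=
  if s is z :: s' then exists c : nat, pspan s' (x - c%:R * z) else x = 0.

Fixpoint pfree s : Prop :=
  if s is z :: s' then ~ pspan s' z /\ pfree s' else True.

Lemma natr_inv c : ~~ (p %| c)%N -> exists b : nat, (b * c)%:R = 1 :> E.
Proof.
move=> ndvd; have c0 : (0 < c)%N by case: c ndvd; rewrite ?dvdn0.
have /eqP cop : coprime c p by rewrite coprime_sym prime_coprime.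
have [u v h _] := egcdnP p c0; exists u.
by rewrite h cop natrD natrM (pcharf0 charE) mulr0 add0r.
Qed.

Lemma opp_natr : exists b : nat, b%:R = -1 :> E.
Proof.
exists p.-1; apply/eqP; rewrite -addr_eq0 natr1 prednK ?prime_gt0 //.
by rewrite (pcharf0 charE).
Qed.

Lemma pspan0 s : pspan s 0.
Proof. by elim: s => //= z s IHs; exists 0%N; rewrite mul0r subr0. Qed.

Lemma pspanD s x y : pspan s x -> pspan s y -> pspan s (x + y).
Proof.
elim: s x y => [|z s IHs] x y /=; first by move=> -> ->; rewrite addr0.
move=> [c cx] [d dy]; exists (c + d)%N.
by rewrite natrD mulrDl opprD addrACA; apply: IHs.
Qed.

Lemma pspanMn s c x : pspan s x -> pspan s (c%:R * x).
Proof.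
move=> sx; elim: c => [|c IHc]; first by rewrite mul0r; apply: pspan0.
by rewrite -addn1 natrD mulrDl mul1r; apply: pspanD.
Qed.

Lemma pspanB s x y : pspan s x -> pspan s y -> pspan s (x - y).
Proof.
have [b b1] := opp_natr => sx sy.
by apply: pspanD => //; rewrite -mulN1r -b1; apply: pspanMn.
Qed.

Lemma pspan_cons z s x : pspan s x -> pspan (z :: s) x.
Proof. by exists 0%N; rewrite mul0r subr0. Qed.

Lemma pspan_mem s x : x \in s -> pspan s x.
Proof.
elim: s => //= z s IHs; rewrite in_cons => /predU1P [->|/IHs sx].
  by exists 1%N; rewrite mul1r subrr; apply: pspan0.
exact: pspan_cons.
Qed.

Lemma pspan_min (P : E -> Prop) s x :
  P 0 -> (forall x y, P x -> P y -> P (x + y)) ->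
  (forall z, z \in s -> P z) -> pspan s x -> P x.
Proof.
move=> P0 PD; elim: s x => [|z s IHs] x Ps /=; first by move=> ->.
move=> [c sx]; rewrite -[x](subrK (c%:R * z)); apply: (PD).
  by apply: IHs => // y ys; apply: Ps; rewrite in_cons ys orbT.
elim: c {sx} => [|c IHc]; first by rewrite mul0r.
rewrite -addn1 natrD mulrDl mul1r; apply: (PD) => //.
by apply: Ps; rewrite mem_head.
Qed.

Lemma pspan_sub s s' x :
  (forall z, z \in s -> pspan s' z) -> pspan s x -> pspan s' x.
Proof. by apply: pspan_min; [exact: pspan0 | exact: pspanD]. Qed.

(* A proper subgroup [P] of the span lies in a hyperplane: [H] is a basis of
   that hyperplane, and [z] spans a complement. *)
Lemma pspan_hyperplane (P : E -> Prop) s :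
  P 0 -> (forall x y, P x -> P y -> P (x + y)) ->
  pfree s -> (exists2 x, x \in s & ~ P x) ->
  exists z H, [/\ (size H).+1 = size s,
    forall x, x \in z :: H -> pspan s x, pfree H
    & forall u, pspan H u -> ~ P (z - u)].
Proof.
move=> P0 PD; have PMn c x : P x -> P (c%:R * x).
  move=> Px; elim: c => [|c IHc]; first by rewrite mul0r.
  by rewrite -addn1 natrD mulrDl mul1r; apply: (PD).
elim: s => [|x s IHs]; first by move=> _ [].
move=> /= [nsx fs] exP.
have [sP|] := pselect (forall y, y \in s -> P y).
  have nPx : ~ P x.
    by case: exP => y; rewrite in_cons => /predU1P [->|/sP].
  exists x, s; split => //; first exact: (@pspan_mem (x :: s)).
  move=> u su Pxu; apply: nPx; rewrite -[x](subrK u); apply: (PD) => //.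
  by apply: pspan_min su.
move=> /existsNP [y /not_implyP [ys nPy]].
have [] := IHs fs; first by exists y.
move=> z [H [sH zH fH nP]].
(* [x] is corrected by a multiple of [z] so that it can join [H]. If some [x - b z] lies in [P]
   modulo the span of [H], that [b] works, since [x] can then be eliminated; otherwise [b = 0]
   works, since a combination with [c] prime to [p] could be divided by [-c]. *)
have [b bP] : exists b : nat, forall u, pspan H u -> forall c,
    ~ P (z - c%:R * (x - b%:R * z) - u).
  have [[b [u [Hu Pxu]]]|nex] :=
    pselect (exists b u, pspan H u /\ P (x - b%:R * z - u)).
    exists b => u' Hu' c Pz.
    have := PD _ _ Pz (PMn c _ Pxu).
    have -> : z - c%:R * (x - b%:R * z) - u' + c%:R * (x - b%:R * z - u)
      = z - (u' + c%:R * u) by ring.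
    by apply: nP; apply: pspanD => //; apply: pspanMn.
  exists 0%N => u Hu c Pz; have [cp|ncp] := boolP (p %| c)%N.
    move: Pz; move: cp; rewrite (dvdn_pcharf charE) => /eqP ->.
    by rewrite mul0r subr0; apply: nP.
  have [d d1] := natr_inv ncp; have [e e1] := opp_natr.
  apply: nex; exists d, (e%:R * (d%:R * u)); split.
    by do 2!apply: pspanMn.
  have := PMn e _ (PMn d _ Pz); congr P.
  rewrite mul0r subr0 e1; transitivity (d%:R * c%:R * x - d%:R * z + d%:R * u).
    by ring.
  by rewrite -natrM d1; ring.
exists z, ((x - b%:R * z) :: H); split.
- by rewrite /= sH.
- move=> w; rewrite !in_cons => /or3P [/eqP ->|/eqP ->|wH].
  + by apply: pspan_cons; apply: zH; rewrite mem_head.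
  + apply: (@pspanB (x :: s)); first by apply: pspan_mem; rewrite mem_head.
    by apply/pspan_cons/pspanMn/zH; rewrite mem_head.
  + by apply: pspan_cons; apply: zH; rewrite in_cons wH orbT.
- split => // Hx; apply: nsx; rewrite -[x](subrK (b%:R * z)).
  apply: pspanD; last by apply/pspanMn/zH; rewrite mem_head.
  by apply: pspan_sub Hx => w wH; apply: zH; rewrite in_cons wH orbT.
- move=> u [c Hu] Pz; apply: (bP _ Hu c); congr P: Pz; ring.
Qed.

(* [espan s] is the polynomial [\prod_u (X - u)], [u] in the span of [s], when
   [s] is free; [moore s] is then the determinant of the [z ^+ (p ^ k)]. *)
Fixpoint espan s x : E :=
  if s is z :: s' then espan s' x ^+ p - espan s' z ^+ p.-1 * espan s' x else x.

Fixpoint moore s : E := if s is z :: s' then espan s' z * moore s' else 1.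

Lemma espanD s x y : espan s (x + y) = espan s x + espan s y.
Proof.
by elim: s x y => //= z s IHs x y; rewrite !IHs exprDp1 mulrDr opprD addrACA.
Qed.

Lemma espan0 s : espan s 0 = 0.
Proof.
elim: s => //= z s ->; rewrite mulr0 subr0 expr0n.
by rewrite -leqn0 leqNgt prime_gt0.
Qed.

Lemma espanMn s c x : espan s (c%:R * x) = c%:R * espan s x.
Proof.
elim: c => [|c IHc]; first by rewrite !mul0r espan0.
by rewrite -addn1 natrD !mulrDl !mul1r espanD IHc.
Qed.

Lemma espanN s x : espan s (- x) = - espan s x.
Proof. by apply/eqP; rewrite -addr_eq0 -espanD addNr espan0. Qed.

(** By additivity of [espan s] this is [frob_prod] at its values in [x] and [z]; iterated, it splits
    [espan s x] into the factors [x - u], [u] in the span. *)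
Lemma espan_cons z s x :
  espan (z :: s) x = \prod_(c < p) espan s (x - (c : nat)%:R * z).
Proof.
rewrite /= frob_prod; apply: eq_bigr => c _.
by rewrite espanD espanN espanMn.
Qed.

Lemma espan_mem s x : x \in s -> espan s x = 0.
Proof.
elim: s => //= z s IHs; rewrite in_cons => /predU1P [->|/IHs ->].
  by rewrite -exprSr prednK ?prime_gt0 // subrr.
by rewrite mulr0 subr0 expr0n -leqn0 leqNgt prime_gt0.
Qed.

Lemma moore_neq0 s : pfree s -> moore s != 0.
Proof.
have esp z s' : ~ pspan s' z -> espan s' z != 0.
  elim: s' z => [|y s' IHs] z /=; first by move/eqP.
  move=> nsp; rewrite -/(espan (y :: s') z) espan_cons.
  apply/prodf_neq0 => c _; apply: IHs => sp; apply: nsp; by exists c.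
elim: s => [|z s IHs] /=; first by rewrite oner_neq0.
by move=> [nz fs]; rewrite mulf_neq0 ?IHs ?esp.
Qed.

(** Additive polynomials are kept as functions with existential coefficients: for determinants only
    the degree [p^n] and the leading coefficient 1 matter. *)
Definition monic_additive n (f : E -> E) : Prop :=
  exists c : nat -> E, forall x,
    f x = x ^+ (p ^ n) + \sum_(i < n) c i * x ^+ (p ^ i).

Lemma monic_additive_widen n m (f : E -> E) : (n < m)%N -> monic_additive n f ->
  exists c : nat -> E, forall x, f x = \sum_(i < m) c i * x ^+ (p ^ i).
Proof.
move=> nm [c fE].
exists (fun i => if (i < n)%N then c i else (i == n)%:R) => x.
rewrite fE -(big_mkord xpredT
  (fun i => (if (i < n)%N then c i else (i == n)%:R) * x ^+ (p ^ i))).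
rewrite (big_cat_nat (n := n)) ?(ltnW nm) //= addrC; congr (_ + _); last first.
  by rewrite big_mkord; apply: eq_bigr => i _; rewrite ltn_ord.
rewrite big_ltn // ltnn eqxx mul1r big_nat_cond big1 ?addr0 // => i.
by move=> /andP [/andP [ni _] _]; rewrite ltnNge (ltnW ni) /= gtn_eqF ?mul0r.
Qed.

Lemma monic_additive_sum n (f : E -> E) (I : Type) (r : seq I) (P : pred I)
    (d : I -> nat) (a : I -> E) (g : I -> E -> E) :
  monic_additive n f ->
  (forall i, P i -> (d i < n)%N /\ monic_additive (d i) (g i)) ->
  monic_additive n (fun x => f x + \sum_(i <- r | P i) a i * g i x).
Proof.
move=> fn gd; suff [c cE] : exists c : nat -> E, forall x,
    \sum_(i <- r | P i) a i * g i x = \sum_(i < n) c i * x ^+ (p ^ i).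
  have [b fE] := fn; exists (fun i => b i + c i) => x.
  rewrite fE cE -addrA -big_split /=; congr (_ + _).
  by apply: eq_bigr => i _; rewrite mulrDl.
elim: r => [|i r [c IHr]].
  exists (fun=> 0) => x; rewrite big_nil big1 // => i _; exact: mul0r.
have [Pi|nPi] := boolP (P i); last first.
  by exists c => x; rewrite big_cons (negbTE nPi).
have [di gi] := gd i Pi; have [b bE] := monic_additive_widen di gi.
exists (fun k => a i * b k + c k) => x.
rewrite big_cons Pi IHr bE mulr_sumr -big_split /=.
by apply: eq_bigr => k _; rewrite mulrDl mulrA.
Qed.

Lemma monic_additive_ext n (f g : E -> E) :
  f =1 g -> monic_additive n f -> monic_additive n g.
Proof. by move=> fg [c fE]; exists c => x; rewrite -fg. Qed.

Lemma monic_additive_id : monic_additive 0 id.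
Proof. by exists (fun=> 0) => x; rewrite big_ord0 addr0 expn0 expr1. Qed.

Lemma monic_additive_exp n m (f : E -> E) :
  monic_additive n f -> monic_additive (n + m) (fun x => f x ^+ (p ^ m)).
Proof.
move=> [c fE].
exists (fun i => if (i < m)%N then 0 else c (i - m)%N ^+ (p ^ m)) => x.
rewrite fE exprDp -exprM -expnD; congr (_ + _).
rewrite expr_sum_p addnC big_split_ord /= [in RHS]big1 ?add0r; last first.
  by move=> i _; rewrite ltn_ord mul0r.
apply: eq_bigr => i _; rewrite ltnNge leq_addr /= addKn exprMn -exprM -expnD.
by rewrite addnC.
Qed.

Lemma monic_additive_espan s : monic_additive (size s) (espan s).
Proof.
elim: s => [|z s IHs] /=; first exact: monic_additive_id.
have := @monic_additive_sum (size s).+1 (fun x => espan s x ^+ p) nat [:: 0%N]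
  xpredT (fun=> size s) (fun=> - espan s z ^+ p.-1) (fun=> espan s).
move=> H; apply: monic_additive_ext (H _ _) => [x||//].
  by rewrite big_cons big_nil addr0 mulNr.
by have := monic_additive_exp 1 IHs; rewrite addn1 expn1.
Qed.

(** The left matrix is the Moore matrix times the transpose of the unitriangular matrix [T] of
    coefficients. *)
Lemma det_monic_additive n (f : nat -> E -> E) (w : nat -> E) :
  (forall k, (k < n)%N -> monic_additive k (f k)) ->
  \det (\matrix_(i < n, k < n) f k (w i))
    = \det (\matrix_(i < n, k < n) w i ^+ (p ^ k)).
Proof.
move=> fm; have [c cE] : exists c : nat -> nat -> E, forall k, (k < n)%N ->
    forall x, f k x = x ^+ (p ^ k) + \sum_(i < k) c k i * x ^+ (p ^ i).
  have /choice [c cE] : forall k, exists c : nat -> E, (k < n)%N ->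
      forall x, f k x = x ^+ (p ^ k) + \sum_(i < k) c i * x ^+ (p ^ i).
    move=> k; have [/fm [c cE]|_] := ltnP k n; first by exists c.
    by exists (fun=> 0).
  by exists c.
pose T := \matrix_(k < n, l < n)
  (if (k == l :> nat) then 1 else if (l < k)%N then c k l else 0 : E).
have -> : \matrix_(i < n, k < n) f k (w i)
    = (\matrix_(i < n, k < n) w i ^+ (p ^ k)) *m T^T.
  apply/matrixP => i k; rewrite !mxE cE // (bigD1 k) //= !mxE eqxx mulr1.
  congr (_ + _).
  rewrite -(big_mkord xpredT (fun l => c k l * w i ^+ (p ^ l))).
  rewrite (big_nat_widen 0 k n) ?(ltnW (ltn_ord k)) //= big_mkord.
  rewrite big_mkcond [RHS]big_mkcond; apply: eq_bigr => l _; rewrite !mxE.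
  rewrite -val_eqE eq_sym /=.
  by have [lk|lk|/= lk] := ltngtP l k; rewrite //= ?mulr0 // mulrC.
rewrite det_mulmx det_tr [\det T]det_trig; last first.
  apply/is_trig_mxP => k l kl; rewrite mxE ltn_eqF //.
  by rewrite ltnNge (ltnW kl).
by rewrite big1 ?mulr1 // => k _; rewrite mxE eqxx.
Qed.

(** The recursion is unrolled from the end of the list, so that factor [i] involves the span of the
    last [i] vectors. *)
Lemma mooreE s :
  moore s = \prod_(i < size s)
    espan (drop (size s - i) s) (nth 0 s (size s - i.+1)).
Proof.
elim: s => [|z s IHs] /=; first by rewrite big_ord0.
rewrite big_ord_recr /= subnn subSnn /= drop0 mulrC IHs; congr (_ * _).
apply: eq_bigr => i _ /=; rewrite subSn ?(ltnW (ltn_ord i)) //=.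
by rewrite subSS -[(size s - i)%N]prednK ?subn_gt0 //= -subnS.
Qed.

(** The [espan] of the last [k] vectors is monic of degree [p^k] and kills these vectors. With such
    columns the matrix is triangular, with the factors of [mooreE] on the diagonal; by
    [det_monic_additive] all monic columns give the same determinant. *)
Lemma moore_det s (f : nat -> E -> E) :
  (forall k, (k < size s)%N -> monic_additive k (f k)) ->
  moore s = \det (\matrix_(i < size s, k < size s)
                    f k (nth 0 s (size s - i.+1))).
Proof.
move=> fm; set n := size s; pose w i := nth 0 s (n - i.+1).
rewrite (@det_monic_additive n f w fm).
rewrite -(@det_monic_additive n (fun k => espan (drop (n - k) s)) w); last first.
  move=> k kn; have := monic_additive_espan (drop (n - k) s).
  by rewrite size_drop subKn // ltnW.
rewrite det_trig ?mooreE; first by apply: eq_bigr => i _; rewrite mxE.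
apply/is_trig_mxP => i k ik; rewrite mxE; apply: espan_mem.
have wE : w i = nth 0 (drop (n - k) s) (k - i.+1).
  rewrite nth_drop /w; congr nth.
  by have := ltn_ord k; have := ltn_ord i; lia.
rewrite wE mem_nth // size_drop subKn ?(ltnW (ltn_ord k)) //.
by have := ltn_ord k; lia.
Qed.

End Moore.

(** * Real valuations *)

Section RealValuation.
Variables (R : realFieldType) (E : fieldType).
Implicit Types (N : E -> R) (x y z : E) (b c : R).

Definition real_valuation N : Prop :=
  (forall x y, x != 0 -> y != 0 -> N (x * y) = N x + N y) /\
  (forall x y, x != 0 -> y != 0 -> x + y != 0 ->
     Num.min (N x) (N y) <= N (x + y)).

(* The value of [N] at [0] is junk; [vge] treats it as infinite. *)
Definition vge N b x : Prop := x = 0 \/ b <= N x.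

Variable N : E -> R.
Hypothesis NP : real_valuation N.

Lemma rvalM x y : x != 0 -> y != 0 -> N (x * y) = N x + N y.
Proof. exact: NP.1. Qed.

Lemma rval1 : N 1 = 0.
Proof.
have := rvalM (oner_neq0 E) (oner_neq0 E); rewrite mulr1 => h.
by apply: (addrI (N 1)); rewrite addr0 -h.
Qed.

Lemma rvalX n x : x != 0 -> N (x ^+ n) = n%:R * N x.
Proof.
move=> x0; elim: n => [|n IHn]; first by rewrite expr0 rval1 mul0r.
by rewrite exprS rvalM ?expf_neq0 // IHn -[n.+1]addn1 natrD; ring.
Qed.

Lemma rvalV x : x != 0 -> N x^-1 = - N x.
Proof.
move=> x0; apply/eqP; rewrite -addr_eq0 addrC -rvalM ?invr_eq0 //.
by rewrite divff // rval1.
Qed.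

Lemma rvalf x y : x != 0 -> y != 0 -> N (x / y) = N x - N y.
Proof. by move=> x0 y0; rewrite rvalM ?invr_eq0 // rvalV. Qed.

Lemma rvalN x : N (- x) = N x.
Proof.
have [->|x0] := eqVneq x 0; first by rewrite oppr0.
have m1 : (-1 : E) != 0 by rewrite oppr_eq0 oner_eq0.
rewrite -mulN1r rvalM //.
have := rvalM m1 m1; rewrite mulrNN mulr1 rval1 => h.
have -> : N (-1) = 0 by lra.
by rewrite add0r.
Qed.

Lemma vge0 b : vge N b 0.
Proof. by left. Qed.

Lemma vge_neq0 b x : x != 0 -> vge N b x -> b <= N x.
Proof. by move=> /eqP x0 []. Qed.

Lemma vge_le b c x : b <= c -> vge N c x -> vge N b x.
Proof. by move=> bc [->|cx]; [left | right; apply: le_trans cx]. Qed.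

Lemma vgeN b x : vge N b x -> vge N b (- x).
Proof. by move=> [->|bx]; [left; rewrite oppr0 | right; rewrite rvalN]. Qed.

Lemma vgeD b x y : vge N b x -> vge N b y -> vge N b (x + y).
Proof.
move=> hx hy.
have [->|x0] := eqVneq x 0; first by rewrite add0r.
have [->|y0] := eqVneq y 0; first by rewrite addr0.
have [->|xy0] := eqVneq (x + y) 0; first by left.
right; apply: le_trans (NP.2 _ _ x0 y0 xy0).
by rewrite le_min (vge_neq0 x0 hx) (vge_neq0 y0 hy).
Qed.

Lemma vgeB b x y : vge N b x -> vge N b y -> vge N b (x - y).
Proof. by move=> hx hy; apply: vgeD => //; apply: vgeN. Qed.

Lemma vge_sum b (I : Type) (r : seq I) (P : pred I) (F : I -> E) :
  (forall i, P i -> vge N b (F i)) -> vge N b (\sum_(i <- r | P i) F i).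
Proof. by move=> h; apply: big_ind => //; [exact: vge0 | exact: vgeD]. Qed.

Lemma vgeM b c x y : vge N b x -> vge N c y -> vge N (b + c) (x * y).
Proof.
move=> hx hy.
have [->|x0] := eqVneq x 0; first by left; rewrite mul0r.
have [->|y0] := eqVneq y 0; first by left; rewrite mulr0.
by right; rewrite rvalM // lerD // vge_neq0.
Qed.

Lemma vge_prod (I : Type) (r : seq I) (P : pred I) (b : I -> R) (F : I -> E) :
  (forall i, P i -> vge N (b i) (F i)) ->
  vge N (\sum_(i <- r | P i) b i) (\prod_(i <- r | P i) F i).
Proof.
move=> h; elim/big_rec2: _ => [|i b' x Pi hx]; first by right; rewrite rval1.
by apply: vgeM => //; apply: h.
Qed.

Lemma vgeX b n x : vge N b x -> vge N (n%:R * b) (x ^+ n).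
Proof.
move=> hx; have := @vge_prod _ (index_enum 'I_n) xpredT (fun=> b) (fun=> x).
rewrite prodr_const sumr_const card_ord mulr_natl; apply => i _; exact: hx.
Qed.

Lemma vge_sign b (n : bool) x : vge N b x -> vge N b ((-1) ^+ n * x).
Proof. by move=> hx; rewrite mulr_sign; case: ifP => _ //; apply: vgeN. Qed.

(** Each term of the Leibniz expansion takes exactly one entry from every column. *)
Lemma vge_det n (b : 'I_n -> R) (M : 'M[E]_n) :
  (forall i k, vge N (b k) (M i k)) -> vge N (\sum_k b k) (\det M).
Proof.
move=> h; apply: vge_sum => s _; apply: vge_sign.
rewrite (reindex_inj (@perm.perm_inj _ s)) /=.
by apply: vge_prod => i _; apply: h.
Qed.

Lemma rval_sum_lt (I : finType) (F : I -> E) (i0 : I) :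
  F i0 != 0 -> (forall i, i != i0 -> F i = 0 \/ N (F i0) < N (F i)) ->
  \sum_i F i != 0 /\ N (\sum_i F i) = N (F i0).
Proof.
move=> F0 lt; rewrite (bigD1 i0) //=; set S := \sum_(i | _) _.
have [->|S0] := eqVneq S 0; first by rewrite addr0.
have ltS : N (F i0) < N S.
  have : vge N (N (F i0)) S /\ exists e, 0 < e /\ vge N (N (F i0) + e) S.
    (* The smallest gap, capped by 1 to cover an empty family; it turns the strict inequalities into
       a uniform one that passes to the sum. *)
    pose e := \big[Num.min/1]_(i | (i != i0) && (F i != 0)) (N (F i) - N (F i0)).
    have e_gt0 : 0 < e.
      rewrite /e; elim/big_ind: _ => //; first by move=> a b; rewrite lt_min => -> ->.
      by move=> i /andP [/lt [->|]]; rewrite ?eqxx // subr_gt0.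
    have Se : vge N (N (F i0) + e) S.
      apply: vge_sum => i ii0; have [->|Fi0] := eqVneq (F i) 0; first by left.
      right; rewrite addrC -lerBrDr /e (bigD1 i) ?ii0 ?Fi0 //=.
      by rewrite ge_min lexx.
    split; last by exists e.
    by apply: vge_le Se; rewrite lerDl ltW.
  by move=> [_ [e [e0 /(vge_neq0 S0)]]]; apply: lt_le_trans; rewrite ltrDl.
have FS0 : F i0 + S != 0.
  by apply/eqP => /eqP; rewrite addr_eq0 => /eqP h; move: ltS; rewrite h rvalN ltxx.
split => //; apply/eqP; rewrite eq_le; apply/andP; split; last first.
  by apply: le_trans (NP.2 _ _ F0 S0 FS0); rewrite le_min lexx ltW.
rewrite leNgt; apply/negP => lt1.
have : vge N (Num.min (N (F i0 + S)) (N S)) (F i0 + S - S).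
  by apply: vgeB; right; rewrite ge_min lexx ?orbT.
by rewrite addrK => /(vge_neq0 F0); rewrite leNgt lt_min lt1 ltS.
Qed.

End RealValuation.

(** * Valuations of Moore determinants *)

Section MooreValuation.
Variables (R : realFieldType) (E : fieldType) (p : nat).
Hypothesis charE : p \in [pchar E].
Variable N : E -> R.
Hypothesis NP : real_valuation N.
Implicit Types (s : seq E) (x z : E).

Lemma vge_moore s (b : nat -> R) (f : nat -> E -> E) :
  (forall k, (k < size s)%N -> monic_additive p k (f k)) ->
  (forall k z, (k < size s)%N -> z \in s -> vge N (b k) (f k z)) ->
  vge N (\sum_(k < size s) b k) (moore p s).
Proof.
move=> fm fb; rewrite (moore_det charE fm); apply: vge_det => // i k.
rewrite mxE; apply: fb => //; apply: mem_nth.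
by rewrite ltn_subrL (leq_ltn_trans _ (ltn_ord i)).
Qed.

(** [espan s x] is a product of [p ^ size s] differences [x - u], each of valuation below [b]. *)
Lemma espan_le s x b :
  (forall u, pspan s u -> ~ vge N b (x - u)) ->
  espan p s x != 0 /\ N (espan p s x) <= (p ^ size s)%:R * b.
Proof.
elim: s x => [|z s IHs] x nv.
  have := nv 0 erefl; rewrite subr0 mul1r => nx.
  split; first by apply/eqP => x0; apply: nx; left.
  by rewrite leNgt; apply/negP => bx; apply: nx; right; apply: ltW.
rewrite (espan_cons charE).
have h (c : 'I_p) : espan p s (x - (c : nat)%:R * z) != 0 /\
    N (espan p s (x - (c : nat)%:R * z)) <= (p ^ size s)%:R * b.
  apply: IHs => u su vu; apply: (nv (u + (c : nat)%:R * z)).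
    by exists c; rewrite addrK.
  by move: vu; rewrite opprD addrAC addrA.
split; first by apply/prodf_neq0 => c _; case: (h c).
rewrite /= expnS natrM -mulrA.
have : \prod_(c < p) espan p s (x - (c : nat)%:R * z) != 0 /\
   N (\prod_(c < p) espan p s (x - (c : nat)%:R * z))
     <= \sum_(c < p) (p ^ size s)%:R * b.
  elim/big_rec2: _ => [|c b' y _ [y0 yb]]; first by rewrite rval1 ?oner_neq0.
  have [e0 eb] := h c; rewrite mulf_neq0 //; split => //.
  by rewrite (rvalM NP) // lerD.
by rewrite sumr_const card_ord [p%:R * _]mulr_natl => -[].
Qed.

End MooreValuation.

(** * Valuations of Moore determinants along an orbit *)

Lemma sum_pow_le p n : (1 < p)%N -> (\sum_(k < n) p ^ k <= p ^ n)%N.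
Proof.
move=> p1; elim: n => [|n IHn]; first by rewrite big_ord0.
rewrite big_ord_recr /= expnS (leq_trans (leq_add IHn (leqnn _))) //.
by rewrite addnn -mul2n leq_mul2r p1 orbT.
Qed.

Section Orbit.
Variables (E : fieldType) (p f r : nat) (A : nat -> E).
Hypothesis charE : p \in [pchar E].
Hypotheses (f_gt0 : (0 < f)%N) (r_gt0 : (0 < r)%N) (Ar_neq0 : A r != 0).
Let q := (p ^ f)%N.
Let p_prime : prime p := pcharf_prime charE.

Definition addpoly (x : E) : E := \sum_(i < r.+1) A i * x ^+ (q ^ i).

Lemma expn_qi i : (q ^ i = p ^ (f * i))%N.
Proof. by rewrite /q -expnM. Qed.

Lemma addpolyD x y : addpoly (x + y) = addpoly x + addpoly y.
Proof.
rewrite /addpoly -big_split; apply: eq_bigr => i _.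
by rewrite expn_qi (exprDp charE) mulrDr.
Qed.

Lemma addpoly0 : addpoly 0 = 0.
Proof.
rewrite /addpoly big1 // => i _; rewrite expr0n expn_eq0 expn_eq0.
by rewrite -leqn0 leqNgt prime_gt0 //= mulr0.
Qed.

Lemma iter_addpolyD k x y :
  iter k addpoly (x + y) = iter k addpoly x + iter k addpoly y.
Proof. by elim: k => //= k ->; rewrite addpolyD. Qed.

Lemma iter_addpoly0 k : iter k addpoly 0 = 0.
Proof. by elim: k => //= k ->; rewrite addpoly0. Qed.

(** The latest iterate comes first, so that the tail of a free orbit list is again a free orbit
    list. *)
Fixpoint orbit_seq n (x : E) : seq E :=
  if n is n'.+1 then iter n' addpoly x :: orbit_seq n' x else [::].

Lemma size_orbit_seq n x : size (orbit_seq n x) = n.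
Proof. by elim: n => //= n ->. Qed.

Lemma orbit_seqP n x z :
  z \in orbit_seq n x -> exists2 k, (k < n)%N & z = iter k addpoly x.
Proof.
elim: n => //= n IHn; rewrite in_cons => /predU1P [->|/IHn [k kn ->]].
  by exists n.
by exists k => //; apply: leqW.
Qed.

Lemma mem_orbit_seq n k x : (k < n)%N -> iter k addpoly x \in orbit_seq n x.
Proof.
elim: n => //= n IHn; rewrite ltnS leq_eqVlt in_cons.
by move=> /predU1P [->|/IHn ->]; rewrite ?eqxx ?orbT.
Qed.

(** Leading coefficient of the [k]-th iterate of [addpoly]. *)
Fixpoint orbit_lead k : E :=
  if k is k'.+1 then A r * orbit_lead k' ^+ (q ^ r) else 1.

Lemma orbit_lead_neq0 k : orbit_lead k != 0.
Proof. by elim: k => [|k IHk] /=; rewrite ?oner_neq0 ?mulf_neq0 ?expf_neq0. Qed.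

Lemma monic_iter_addpoly k :
  monic_additive p (f * r * k) (fun x => iter k addpoly x / orbit_lead k).
Proof.
elim: k => [|k IHk].
  rewrite muln0; apply: monic_additive_ext (@monic_additive_id E p) => x.
  by rewrite /= divr1.
pose F x := iter k addpoly x / orbit_lead k.
have c0 := orbit_lead_neq0 k.
have := @monic_additive_sum E p (f * r * k.+1)%N (fun x => F x ^+ (q ^ r)) _
  (index_enum 'I_r) xpredT (fun i : 'I_r => f * r * k + f * i)%N
  (fun i : 'I_r => A i * orbit_lead k ^+ (q ^ i) / orbit_lead k.+1)
  (fun i x => F x ^+ (q ^ i)).
move=> H; apply: monic_additive_ext (H _ _) => [x||i _].
- have -> : iter k.+1 addpoly x = addpoly (orbit_lead k * F x).
    by rewrite mulrC divfK.
  rewrite [addpoly _]big_ord_recr mulrDl addrC /=; congr (_ + _).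
    rewrite mulr_suml; apply: eq_bigr => i _.
    rewrite [in RHS]exprMn; move: (_^-1) (F x ^+ (q ^ i)) (orbit_lead k ^+ (q ^ i)).
    by move=> u v w; ring.
  rewrite [in RHS]exprMn mulrA [RHS]mulrAC divff ?mul1r //.
  exact: (orbit_lead_neq0 k.+1).
- rewrite mulnS addnC expn_qi; exact: monic_additive_exp.
- rewrite expn_qi; split; last exact: monic_additive_exp.
  by rewrite mulnS addnC ltn_add2r ltn_mul2l f_gt0 /=.
Qed.

(** Iterates supply the degrees [p^(f r k)]; Frobenius powers of exponent below [f r] fill the gaps,
    so that every degree [p^j] occurs. *)
Definition orbit_col j (x : E) : E :=
  (iter (j %/ (f * r)) addpoly x / orbit_lead (j %/ (f * r)))
    ^+ (p ^ (j %% (f * r))).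

Lemma monic_orbit_col j : monic_additive p j (orbit_col j).
Proof.
rewrite [X in monic_additive _ X _](divn_eq j (f * r)) mulnC.
exact/monic_additive_exp/monic_iter_addpoly.
Qed.

Variables (R : realFieldType) (N : E -> R).
Hypothesis NP : real_valuation N.
Variable g : R.
Hypothesis gE : ((q ^ r)%:R - 1) * g = - N (A r).

(** [orbit_lead k] is the power of [A r] with exponent [((q^r)^k - 1) / (q^r - 1)], and [g] is the
    valuation of an element that conjugates [addpoly] to a monic polynomial. *)
Lemma rval_orbit_lead k : N (orbit_lead k) = - (((q ^ r) ^ k)%:R - 1) * g.
Proof.
elim: k => [|k IHk] /=; first by rewrite (rval1 NP) expn0 subrr oppr0 mul0r.
rewrite (rvalM NP) ?expf_neq0 ?orbit_lead_neq0 // (rvalX NP) ?orbit_lead_neq0 //.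
rewrite IHk -[N (A r)]opprK -gE expnS natrM; ring.
Qed.

(** Only the Frobenius factor [p^(j mod f r) <= q^r] magnifies the error [b]; the rest of the degree
    comes from an iterate, whose valuation is controlled directly. Hence the total loss is linear in
    the number of columns. *)
Lemma vge_orbit_col j x (b : R) : 0 <= b ->
  vge N (g - b) (iter (j %/ (f * r)) addpoly x) ->
  vge N ((p ^ j)%:R * g - (q ^ r)%:R * b) (orbit_col j x).
Proof.
move=> b0; set k := (j %/ (f * r))%N => h; rewrite /orbit_col -/k.
have c0 := orbit_lead_neq0 k.
have hV : vge N (((q ^ r) ^ k)%:R * g - g) (orbit_lead k)^-1.
  by right; rewrite (rvalV NP) // rval_orbit_lead; lra.
have := vgeX NP (p ^ (j %% (f * r))) (vgeM NP h hV).
apply: vge_le.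
have jE : (p ^ j = p ^ (j %% (f * r)) * (q ^ r) ^ k)%N.
  rewrite /q -!expnM -expnD; congr (_ ^ _)%N.
  by rewrite {1}(divn_eq j (f * r)) addnC [(_ * (f * r))%N]mulnC mulnA.
rewrite jE natrM.
have le_b : (p ^ (j %% (f * r)))%:R * b <= (q ^ r)%:R * b.
  rewrite ler_wpM2r // ler_nat expn_qi leq_exp2l ?prime_gt1 //.
  by rewrite ltnW // ltn_mod muln_gt0 f_gt0.
by lra.
Qed.

(** A column applies at most [n] iterations to a combination of the first [n + 1] orbit points;
    hence the control up to [n + n]. *)
Lemma vge_moore_orbit s x n (b : R) : 0 <= b ->
  (forall k, (k <= n + n)%N -> vge N (g - b) (iter k addpoly x)) ->
  (forall z, z \in s -> pspan (orbit_seq n.+1 x) z) -> (size s <= n.+1)%N ->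
  vge N (\sum_(k < size s) ((p ^ k)%:R * g - (q ^ r)%:R * b)) (moore p s).
Proof.
move=> b0 hx sx sn.
apply: (@vge_moore _ _ p charE N NP s
  (fun k => (p ^ k)%:R * g - (q ^ r)%:R * b) orbit_col) => [k _|k z ks zs].
  exact: monic_orbit_col.
apply: vge_orbit_col => //; set m := (_ %/ _)%N.
have mn : (m <= n)%N.
  by rewrite -ltnS (leq_trans _ sn) // (leq_ltn_trans _ ks) // leq_div.
apply: (@pspan_min _ (fun z => vge N (g - b) (iter m addpoly z)) _ _ _ _ _ (sx z zs)).
- by rewrite iter_addpoly0; left.
- by move=> y y' hy hy'; rewrite iter_addpolyD; apply: vgeD.
- move=> _ /orbit_seqP [k' k'n ->]; rewrite -iterD; apply: hx.
  exact: leq_add.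
Qed.

(** Below [M] the top term has strictly smaller valuation than all others; subtracting [g] absorbs
    [N (A r)]. *)
Lemma addpoly_escape (M : R) z : M <= 0 ->
  (forall i, (i < r)%N -> A i != 0 ->
     ((q ^ r)%:R - (q ^ i)%:R) * M <= N (A i) + ((q ^ i)%:R - 1) * g) ->
  z != 0 -> N z - g < M ->
  addpoly z != 0 /\ N (addpoly z) - g = (q ^ r)%:R * (N z - g).
Proof.
move=> M0 hM z0 zM.
have NF i : A i != 0 -> N (A i * z ^+ (q ^ i)) = N (A i) + (q ^ i)%:R * N z.
  by move=> Ai; rewrite (rvalM NP) ?expf_neq0 // (rvalX NP).
have := @rval_sum_lt _ _ N NP 'I_r.+1 (fun i => A i * z ^+ (q ^ i)) ord_max.
rewrite /= -/(addpoly z) NF // => -[||-> ->].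
- by rewrite mulf_neq0 ?expf_neq0.
- move=> i ir; have [->|Ai] := eqVneq (A i) 0; first by left; rewrite mul0r.
  have {ir} ir : (i < r)%N by rewrite ltn_neqAle -ltnS ltn_ord andbT.
  right; rewrite NF //.
  have lt_q : (q ^ i)%:R < (q ^ r)%:R :> R.
    by rewrite ltr_nat ltn_exp2l // -(expn0 p) ltn_exp2l // prime_gt1.
  have := hM i ir Ai.
  have : ((q ^ r)%:R - (q ^ i)%:R) * (N z - g) < ((q ^ r)%:R - (q ^ i)%:R) * M.
    by rewrite ltr_pM2l ?subr_gt0.
  move: gE; set Q := (q ^ r)%:R; set Qi := (q ^ i)%:R.
  set Nr := N (A r); set Ni := N (A i); set Nz := N z => gE' h1 h2.
  have {h1 h2} h3 := lt_le_trans h1 h2; lra.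
- split => //; move: gE; set Q := (q ^ r)%:R; set Nr := N (A r); lra.
Qed.

(** * A Moore determinant of large valuation at a bad place *)

Section BadPlace.
Variables (i0 : nat) (s0 m0 : R).
Hypotheses (i0_lt : (i0 < r)%N) (Ai0 : A i0 != 0) (s0_gt0 : 0 < s0)
  (m0_gt0 : 0 < m0).
Hypothesis i0_min : N (A i0) + ((q ^ i0)%:R - 1) * g <= - s0 - m0.
Hypothesis i0_last : forall i, (i0 < i <= r)%N -> A i != 0 ->
  N (A i0) + ((q ^ i0)%:R - 1) * g + (q ^ i)%:R * s0 + m0
    <= N (A i) + ((q ^ i)%:R - 1) * g.

(** After conjugation the coefficient of index [i0] has negative valuation, smaller by a margin than
    that of every later coefficient; the polynomial is cut off there and made monic. *)
Definition trunc_addpoly (x : E) : E :=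
  (\sum_(i < i0.+1) A i * x ^+ (q ^ i)) / A i0.

Lemma monic_trunc_addpoly : monic_additive p (f * i0) trunc_addpoly.
Proof.
have := @monic_additive_sum E p (f * i0)%N (fun x => x ^+ (q ^ i0)) _
  (index_enum 'I_i0) xpredT (fun i : 'I_i0 => f * i)%N (fun i => A i / A i0)
  (fun i x => x ^+ (q ^ i)).
have mX i : monic_additive p (f * i) (fun x : E => x ^+ (q ^ i)).
  by rewrite expn_qi; apply: (monic_additive_exp charE (f * i) (@monic_additive_id E p)).
move=> H; apply: monic_additive_ext (H _ _) => [x||i _].
- rewrite /trunc_addpoly big_ord_recr /= mulrDl addrC mulrAC divff // mul1r.
  by congr (_ + _); rewrite mulr_suml; apply: eq_bigr => i _; rewrite mulrAC.
- exact: mX.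
- by split; [rewrite ltn_mul2l f_gt0 /= | exact: mX].
Qed.

(* The top terms of [addpoly z] are small by [i0_last], and [addpoly z] itself
   is small compared with [A i0], so that the truncation has to be small. *)
Lemma vge_trunc_addpoly z : vge N (g - s0) z -> vge N (g - s0) (addpoly z) ->
  vge N ((q ^ i0)%:R * g + m0) (trunc_addpoly z).
Proof.
move=> hz hAz; rewrite /trunc_addpoly.
have -> : (q ^ i0)%:R * g + m0 = ((q ^ i0)%:R * g + m0 + N (A i0)) + - N (A i0).
  by rewrite addrK.
apply: vgeM => //; last by right; rewrite (rvalV NP).
have -> : \sum_(i < i0.+1) A i * z ^+ (q ^ i)
    = addpoly z - \sum_(i < r.+1 | (i0 < i)%N) A i * z ^+ (q ^ i).
  apply/eqP; rewrite eq_sym subr_eq; apply/eqP.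
  rewrite /addpoly (bigID (fun i : 'I_r.+1 => (i < i0.+1)%N)) /=; congr (_ + _).
    by rewrite (@big_ord_widen _ _ _ _ r.+1 (fun i => A i * z ^+ (q ^ i))) // ltnS ltnW.
  by apply: eq_bigl => i; rewrite -leqNgt.
apply: vgeB => //.
  by apply: vge_le hAz; move: i0_min; lra.
apply: vge_sum => // i i0i; have [->|Ai] := eqVneq (A i) 0.
  by left; rewrite mul0r.
have := vgeM NP (or_intror (lexx (N (A i)))) (vgeX NP (q ^ i) hz).
apply: vge_le; have := @i0_last i; rewrite i0i -ltnS ltn_ord => /(_ isT Ai).
by lra.
Qed.

(** Powers of [x] serve as the first [f * i0] columns and lose against the value [p^j g]; Frobenius
    powers of the truncation serve as the others and gain. [bad_bound] records this difference. *)
Let bad_col j (x : E) : E :=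
  if (j < f * i0)%N then x ^+ (p ^ j)
  else trunc_addpoly x ^+ (p ^ (j - f * i0)).

Let bad_bound j : R :=
  if (j < f * i0)%N then - s0 * (p ^ j)%:R else m0 * (p ^ (j - f * i0))%:R.

(** The last column alone contributes [m0 p^(n - f i0 - 1)]; the other gains are dropped, and the
    losses form a geometric sum. *)
Lemma sum_bad_bound n : (f * i0 < n)%N ->
  m0 / (p ^ (f * i0).+1)%:R * (p ^ n)%:R - s0 * (p ^ (f * i0))%:R
    <= \sum_(j < n) bad_bound j.
Proof.
move=> n_gt; pose t := (n - (f * i0).+1)%N.
have nE : n = (f * i0 + t.+1)%N by rewrite addnS -addSn subnKC.
rewrite nE big_split_ord /= addrC; apply: lerD; last first.
  have -> : - (s0 * (p ^ (f * i0))%:R) = - s0 * (p ^ (f * i0))%:R by ring.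
  apply: le_trans (_ : \sum_(i < f * i0) - s0 * (p ^ i)%:R <= _); last first.
    by apply: ler_sum => i _; rewrite /bad_bound ltn_ord.
  rewrite -mulr_sumr ler_nM2l ?oppr_lt0 // -natr_sum ler_nat.
  exact/sum_pow_le/prime_gt1.
apply: le_trans (_ : \sum_(i < t.+1) m0 * (p ^ i)%:R <= _); last first.
  by apply: ler_sum => i _; rewrite /bad_bound ltnNge leq_addr /= addKn.
rewrite big_ord_recr /= -[leLHS]add0r; apply: lerD.
  by apply: sumr_ge0 => i _; rewrite mulr_ge0 ?ler0n // ltW.
have p0 : (p ^ (f * i0).+1)%:R != 0 :> R.
  by rewrite pnatr_eq0 expn_eq0 -leqn0 leqNgt prime_gt0.
by rewrite addnS -addSn expnD natrM mulrA divfK.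
Qed.

Lemma exists_moore_bad n x (b : R) : (f * i0 < n)%N -> 0 <= b ->
  (forall k, (k <= n + n)%N -> vge N (g - b) (iter k addpoly x)) ->
  pfree (orbit_seq n.+1 x) ->
  exists H, [/\ size H = n, pfree H,
    forall z, z \in H -> pspan (orbit_seq n.+1 x) z
    & \sum_(k < n) (p ^ k)%:R * g
      + Num.min s0 (m0 / (p ^ (f * i0).+1)%:R) * (p ^ n)%:R
      - s0 * (p ^ (f * i0))%:R - n.+1%:R * (q ^ r)%:R * b <= N (moore p H)].
Proof.
move=> n_gt b0 hx fx; set k0 := Num.min _ _.
have pn0 : 0 <= (p ^ n)%:R :> R by exact: ler0n.
have sp0 : 0 <= s0 * (p ^ (f * i0))%:R by rewrite mulr_ge0 ?ler0n // ltW.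
have Db0 : 0 <= n.+1%:R * (q ^ r)%:R * b by rewrite !mulr_ge0 ?ler0n.
(* If the whole orbit is close to [g], use the columns [bad_col]; otherwise pass
   to a hyperplane [H] containing every vector of valuation at least [g - s0]:
   all [p ^ n] factors of [espan H z] then have valuation below [g - s0]. *)
have [allP|nallP] :=
  pselect (forall z, z \in orbit_seq n.+1 x -> vge N (g - s0) z).
  exists (orbit_seq n x); split.
  - exact: size_orbit_seq.
  - by case: fx.
  - by move=> z zx; apply: pspan_mem => //; rewrite /= in_cons zx orbT.
  have fx' : pfree (orbit_seq n x) by case: fx.
  apply: le_trans (vge_neq0 (moore_neq0 charE fx')
    (@vge_moore _ _ p charE N NP _ (fun k => (p ^ k)%:R * g + bad_bound k)
       bad_col _ _)).
  - rewrite size_orbit_seq big_split /= -!addrA lerD2l addrA.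
    apply: le_trans (sum_bad_bound n_gt).
    have : k0 * (p ^ n)%:R <= m0 / (p ^ (f * i0).+1)%:R * (p ^ n)%:R.
      by rewrite ler_wpM2r // /k0 ge_min lexx orbT.
    by lra.
  - move=> k _; rewrite /bad_col; case: ltnP => ki.
      exact: (monic_additive_exp charE k (@monic_additive_id E p)).
    have := monic_additive_exp charE (k - f * i0) monic_trunc_addpoly.
    by rewrite subnKC.
  - move=> k z _ zx; have hz : vge N (g - s0) z.
      by apply: allP; rewrite in_cons zx orbT.
    rewrite /bad_col /bad_bound; case: ltnP => ki.
      by have := vgeX NP (p ^ k) hz; apply: vge_le; lra.
    have hAz : vge N (g - s0) (addpoly z).
      have [l ln ->] := orbit_seqP zx; rewrite -iterS; apply: allP.
      exact: mem_orbit_seq.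
    have := vgeX NP (p ^ (k - f * i0)) (vge_trunc_addpoly hz hAz).
    apply: vge_le; rewrite -{1}(subnKC ki) expnD -expn_qi natrM; lra.
have nP : exists2 z, z \in orbit_seq n.+1 x & ~ vge N (g - s0) z.
  by have /existsNP [z /not_implyP [zx nz]] := nallP; exists z.
have [z [H [sH zH fH {}nP]]] := pspan_hyperplane charE (vge0 N (g - s0))
  (@vgeD _ _ _ NP (g - s0)) fx nP.
rewrite size_orbit_seq in sH; case: sH => sH.
exists H; split => //.
  by move=> w wH; apply: zH; rewrite in_cons wH orbT.
have [ez0 ez] := espan_le charE NP nP.
have mH0 := moore_neq0 charE fH.
(* [moore (z :: H)] is [espan H z * moore H]. Its last column counts [p^n g], whereas [espan H z]
   has valuation at most [p^n (g - s0)], so that [moore H] gains [s0 p^n]. *)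
have := @vge_moore_orbit (z :: H) x n b b0 hx zH _.
rewrite /= sH => /(_ (leqnn _)) /(vge_neq0 _).
rewrite mulf_neq0 // => /(_ isT); rewrite (rvalM NP) // big_ord_recr /=.
rewrite sumrB sumr_const card_ord sH in ez *.
have : k0 * (p ^ n)%:R <= s0 * (p ^ n)%:R.
  by rewrite ler_wpM2r // /k0 ge_min lexx.
rewrite -[_ *+ n]mulr_natl -[n.+1]addn1 natrD; lra.
Qed.

End BadPlace.
End Orbit.

(** * Evaluation and degree of twisted polynomials *)

Lemma sum_ord_shift (V : nmodType) n i m (F : nat -> V) :
  (i + m <= n)%N -> (forall k, (i + m <= k)%N -> F k = 0) ->
  \sum_(k < n | (i <= k)%N) F k = \sum_(l < m) F (i + l)%N.
Proof.
move=> imn F0; rewrite -(big_geq_mkord i n xpredT) -{1}[i]add0n big_addn.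
rewrite (big_cat_nat (n := m)) //=; last by rewrite leq_subRL ?(leq_trans _ imn) ?leq_addr.
rewrite [X in _ + X]big_nat_cond [X in _ + X]big1 ?addr0; last first.
  by move=> l /andP [/andP [ml _] _]; rewrite F0 // addnC leq_add2r.
by rewrite big_mkord; apply: eq_bigr => l _; rewrite addnC.
Qed.

Section Twisted.
Variables (K : fieldType) (p f : nat) (tau : {rmorphism K -> K}).
Hypothesis charK : p \in [pchar K].
Let q := (p ^ f)%N.
Hypothesis tauE : forall x, tau x = x ^+ q.
Hypothesis f_gt0 : (0 < f)%N.
Implicit Types (P Q : twpoly tau).

Let q_gt0 : (0 < q)%N.
Proof. by rewrite expn_gt0 prime_gt0 ?(pcharf_prime charK). Qed.

Let expr0q i : (0 : K) ^+ (q ^ i) = 0.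
Proof. by rewrite expr0n expn_eq0 eqn0Ngt q_gt0. Qed.

Lemma iter_tauE n x : iter n tau x = x ^+ (q ^ n).
Proof.
by elim: n => [|n IHn]; rewrite ?expn0 ?expr1 //= IHn tauE -exprM expnSr.
Qed.

Section Eval.
Variables (E : fieldType) (j : K -> E).
Hypothesis jD : {morph j : x y / x + y}.
Hypothesis jM : {morph j : x y / x * y}.
Hypothesis j1 : j 1 = 1.

(** [j] is a plain function with explicit morphism laws, because it stands both for embeddings and
    for the map [z => z^(p^m)]. *)
Lemma j_0 : j 0 = 0.
Proof. by apply: (addrI (j 0)); rewrite -jD !addr0. Qed.

Lemma j_exp n x : j (x ^+ n) = j x ^+ n.
Proof. by elim: n => [|n IHn]; rewrite ?expr0 // !exprS jM IHn. Qed.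

Lemma j_nat n : j n%:R = n%:R.
Proof. by elim: n => [|n IHn]; rewrite ?j_0 // -natr1 jD IHn j1 natr1. Qed.

Lemma pchar_j : p \in [pchar E].
Proof.
rewrite inE (pcharf_prime charK) /= -j_nat; move: charK; rewrite inE => /andP [_].
by move=> /eqP ->; rewrite j_0.
Qed.

Lemma tweval_addpoly P x :
  tweval q j P x = addpoly p f (twdeg P) (fun i => j (twcoef P i)) x.
Proof. by []. Qed.

Lemma twevalE n P x : (size (P : {poly K}) <= n)%N ->
  tweval q j P x = \sum_(i < n) j (twcoef P i) * x ^+ (q ^ i).
Proof.
have zero i : (size (P : {poly K}) <= i)%N -> j (twcoef P i) * x ^+ (q ^ i) = 0.
  by move=> h; rewrite /twcoef nth_default // j_0 mul0r.
have widen a b : (size (P : {poly K}) <= a)%N -> (a <= b)%N ->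
    \sum_(i < a) j (twcoef P i) * x ^+ (q ^ i)
      = \sum_(i < b) j (twcoef P i) * x ^+ (q ^ i).
  move=> ha ab; rewrite (big_ord_widen b (fun i => j (twcoef P i) * x ^+ (q ^ i))) //.
  rewrite big_mkcond; apply: eq_bigr => i _; case: ltnP => // ai.
  by rewrite zero // (leq_trans ha).
move=> hn; rewrite /tweval /twdeg.
case: (leqP (size (P : {poly K})).-1.+1 n) => hs; first by rewrite (widen _ n) ?leqSpred.
by rewrite -(widen n) // ltnW.
Qed.

Lemma twevalD P Q x : tweval q j (P + Q) x = tweval q j P x + tweval q j Q x.
Proof.
pose n := maxn (size (P : {poly K})) (size (Q : {poly K})).
have hPQ : (size ((P + Q : twpoly tau)%R : {poly K}) <= n)%N by exact: size_polyD.
rewrite (twevalE _ hPQ) (@twevalE n P) ?leq_maxl // (@twevalE n Q) ?leq_maxr //.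
rewrite -big_split /=.
by apply: eq_bigr => i _; rewrite /twcoef coefD jD mulrDl.
Qed.

Lemma tweval0 x : tweval q j (0 : twpoly tau) x = 0.
Proof.
rewrite (@twevalE 0) ?big_ord0 //.
by rewrite (_ : (0 : twpoly tau) = (0 : {poly K})) // size_poly0.
Qed.

Lemma tweval1 x : tweval q j (1 : twpoly tau) x = x.
Proof.
rewrite (@twevalE 1) ?big_ord1 /twcoef ?coefC /= ?j1 ?mul1r ?expr1 //.
exact: size_polyC_leq1.
Qed.

Lemma tweval_natmul P n x : tweval q j (P *+ n) x = n%:R * tweval q j P x.
Proof.
elim: n => [|n IHn]; first by rewrite mulr0n mul0r tweval0.
by rewrite mulrS twevalD IHn -nat1r mulrDl mul1r.
Qed.

Lemma tweval_at0 P : tweval q j P 0 = 0.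
Proof. by rewrite tweval_addpoly (addpoly0 f _ _ pchar_j). Qed.

(** The rule [tau^i c = c^(q^i) tau^i] matches the additive expansion of the outer [q^i]-th powers;
    the rest is a reindexing by [k = i + l]. *)
Lemma twevalM P Q x : tweval q j (P * Q) x = tweval q j P (tweval q j Q x).
Proof.
pose n := size (P : {poly K}); pose m := size (Q : {poly K}).
have sM : (size ((P * Q : twpoly tau)%R : {poly K}) <= n + m)%N by exact: size_poly.
rewrite (twevalE _ sM) (@twevalE n P) // (@twevalE m Q) //.
transitivity (\sum_(k < n + m) \sum_(i < n | (i <= k)%N)
    j (twcoef P i) * j (twcoef Q (k - i)) ^+ (q ^ i) * x ^+ (q ^ k)).
  apply: eq_bigr => k _; rewrite {1}/twcoef [in LHS]coef_twmul.
  rewrite (big_morph j jD j_0) mulr_suml.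
  rewrite -(big_mkord xpredT (fun i => j (P`_i * iter i tau Q`_(k - i)) * x ^+ (q ^ k))).
  rewrite (big_nat_widen 0 k.+1 (n + m)) // big_mkcond /= big_mkord big_split_ord /=.
  rewrite [X in _ + X]big1 ?addr0 => [|i _]; last first.
    case: ifP => // _; rewrite [P`_(n + i)]nth_default ?leq_addr //.
    by rewrite mul0r j_0 mul0r.
  rewrite [RHS]big_mkcond; apply: eq_bigr => i _; rewrite ltnS.
  by case: ifP => // _; rewrite iter_tauE jM j_exp.
rewrite (exchange_big_dep predT) //=; apply: eq_bigr => i _.
have -> : (\sum_(l < m) j (twcoef Q l) * x ^+ (q ^ l)) ^+ (q ^ i)
    = \sum_(l < m) (j (twcoef Q l) * x ^+ (q ^ l)) ^+ (q ^ i).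
  by rewrite expn_qi (expr_sum_p pchar_j).
rewrite mulr_sumr.
transitivity (\sum_(l < m) j (twcoef P i) * j (twcoef Q l) ^+ (q ^ i) * x ^+ (q ^ (i + l))).
  rewrite (@sum_ord_shift _ (n + m) i m (fun k => j (twcoef P i)
    * j (twcoef Q (k - i)) ^+ (q ^ i) * x ^+ (q ^ k))) ?leq_add2r 1?ltnW //.
    by apply: eq_bigr => l _; rewrite addnC addnK.
  move=> k ik; rewrite [twcoef Q _]nth_default ?leq_subRL ?(leq_trans _ ik) ?leq_addr //.
  by rewrite j_0 expr0n expn_eq0 eqn0Ngt q_gt0 mulr0 mul0r.
apply: eq_bigr => l _.
by rewrite exprMn mulrA -exprM expnD mulnC.
Qed.

Lemma twevalX P n x : tweval q j (P ^+ n) x = iter n (tweval q j P) x.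
Proof. by elim: n => [|n IHn]; rewrite ?expr0 ?tweval1 // exprS twevalM IHn. Qed.

End Eval.

Lemma twpoly_neq0P P : P != 0 -> twcoef P (twdeg P) != 0.
Proof. by move=> P0; rewrite -[twcoef _ _]/(lead_coef (P : {poly K})) lead_coef_eq0. Qed.

Lemma twcoef_gt P i : (twdeg P < i)%N -> twcoef P i = 0.
Proof. by rewrite /twdeg /twcoef => h; rewrite nth_default //; case: size h. Qed.

Lemma twcoefM P Q n :
  twcoef (P * Q) n = \sum_(i < n.+1) twcoef P i * twcoef Q (n - i) ^+ (q ^ i).
Proof.
by rewrite /twcoef coef_twmul; apply: eq_bigr => i _; rewrite iter_tauE.
Qed.

Lemma twdeg_le P n : (forall i, (n < i)%N -> twcoef P i = 0) -> (twdeg P <= n)%N.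
Proof.
move=> h; rewrite leqNgt; apply/negP => lt.
have P0 : P != 0 by apply/eqP => P0; move: lt; rewrite P0 /twdeg size_poly0.
by have := twpoly_neq0P P0; rewrite h // eqxx.
Qed.

Lemma twcoefM_lead P Q : twcoef (P * Q) (twdeg P + twdeg Q)
  = twcoef P (twdeg P) * twcoef Q (twdeg Q) ^+ (q ^ twdeg P).
Proof.
have lt : (twdeg P < (twdeg P + twdeg Q).+1)%N by rewrite ltnS leq_addr.
rewrite twcoefM (bigD1 (Ordinal lt)) //= addKn big1 ?addr0 // => i.
rewrite -val_eqE /= neq_ltn => /orP [iP|Pi]; last first.
  by rewrite (twcoef_gt Pi) mul0r.
rewrite [twcoef Q _]twcoef_gt ?expr0q ?mulr0 //.
by rewrite ltn_subRL ltn_add2r.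
Qed.

Lemma twmul_neq0 P Q : P != 0 -> Q != 0 ->
  P * Q != 0 /\ twdeg (P * Q) = (twdeg P + twdeg Q)%N.
Proof.
move=> P0 Q0; have lead0 : twcoef (P * Q) (twdeg P + twdeg Q) != 0.
  by rewrite twcoefM_lead mulf_neq0 ?expf_neq0 ?twpoly_neq0P.
split.
  by apply/eqP => PQ0; move: lead0; rewrite PQ0 /twcoef coef0 eqxx.
apply/eqP; rewrite eqn_leq; apply/andP; split; last first.
  rewrite leqNgt; apply/negP => lt; move: lead0.
  by rewrite (twcoef_gt lt) eqxx.
apply: twdeg_le => n ltn; rewrite twcoefM big1 // => i _.
have [iP|Pi] := leqP i (twdeg P); last by rewrite (twcoef_gt Pi) mul0r.
rewrite [twcoef Q _]twcoef_gt ?expr0q ?mulr0 //.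
rewrite ltn_subRL; apply: leq_ltn_trans ltn.
by rewrite leq_add2r.
Qed.

Lemma twexp_neq0 P n : P != 0 -> P ^+ n != 0 /\ twdeg (P ^+ n) = (n * twdeg P)%N.
Proof.
move=> P0; elim: n => [|n [IH0 IHn]].
  rewrite expr0 oner_neq0 /twdeg; split => //.
  by rewrite (_ : (1 : twpoly tau) = 1%:P) // size_polyC oner_neq0.
by have [h0 hd] := twmul_neq0 P0 IH0; rewrite exprS hd IHn mulSn.
Qed.

(* Only the top index with a nonzero coefficient reaches the maximal degree. *)
Lemma twsum_neq0 n (c : nat -> twpoly tau) P :
  (0 < twdeg P)%N -> (forall i, (i < n)%N -> twdeg (c i) = 0%N) ->
  (exists2 i, (i < n)%N & c i != 0) -> \sum_(i < n) c i * P ^+ i != 0.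
Proof.
move=> P_gt0; have P0 : P != 0.
  by apply/eqP => P0; move: P_gt0; rewrite P0 /twdeg size_poly0.
elim: n => [|n IHn] dc [i]; first by rewrite ltn0.
have [cn0|cn0] := eqVneq (c n) 0.
  move=> lti ci0; rewrite big_ord_recr /= cn0 mul0r addr0.
  apply: IHn => [k kn|]; first by apply: dc; apply: leqW.
  exists i => //; rewrite ltn_neqAle -ltnS lti andbT.
  by apply/eqP => e; move: ci0; rewrite e cn0 eqxx.
move=> _ _; rewrite big_ord_recr /=.
have [X0 Xd] := twexp_neq0 n P0; have [h0 hd] := twmul_neq0 cn0 X0.
have := twpoly_neq0P h0; rewrite hd dc // add0n Xd => top.
apply/eqP => S0; have := congr1 (fun Q : twpoly tau => twcoef Q (n * twdeg P)) S0.
rewrite /twcoef coefD coef0 coef_sum big1 ?add0r => [/eqP|k _].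
  by rewrite (negbTE top).
have [ck|ck] := eqVneq (c k) 0; first by rewrite ck mul0r coef0.
have [Y0 Yd] := twexp_neq0 k P0; have [g0 gd] := twmul_neq0 ck Y0.
have := @twcoef_gt (c k * P ^+ k) (n * twdeg P); rewrite /twcoef; apply.
by rewrite gd Yd dc ?add0n ?ltn_mul2r ?P_gt0 /= // leqW.
Qed.

End Twisted.

(** * Local heights *)

Section LocalHeight.
Variables (R : realType) (E : fieldType) (N : E -> R).
Hypothesis NP : real_valuation N.

Definition minval (x : E) : R := if x == 0 then 0 else Num.min 0 (N x).

Lemma minval_le0 x : minval x <= 0.
Proof. by rewrite /minval; case: ifP => // _; rewrite ge_min lexx. Qed.

Lemma norm_range (x : R) : - `|x| <= x /\ x <= `|x|.
Proof. by apply/andP; rewrite -ler_norml. Qed.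

(** The factors [D^k] would carry a negative [x] below any bound; this turns estimates with a
    bounded error along an orbit into exact ones. *)
Lemma geometric_ge0 (D : nat) (x c : R) : (1 < D)%N ->
  (forall k, - c <= (D ^ k)%:R * x) -> 0 <= x.
Proof.
move=> D1 h; rewrite leNgt; apply/negP => x0.
have y0 : 0 <= `|c| / - x by rewrite divr_ge0 // oppr_ge0 ltW.
have := archi_boundP y0; set k := Num.bound _.
rewrite ltr_pdivrMr ?oppr_gt0 // => hk.
have := h k; have : k%:R < (D ^ k)%:R :> R by rewrite ltr_nat ltn_expl.
have [] := norm_range c => _ c1 hD.
have : (D ^ k)%:R * x < k%:R * x by rewrite ltr_nM2r.
by lra.
Qed.

(** * Effect of an additive polynomial on truncated valuations *)

Section Crude.
Variables (p f r : nat) (A : nat -> E).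
Hypothesis charE : p \in [pchar E].
Hypotheses (f_gt0 : (0 < f)%N) (Ar_neq0 : A r != 0).
Let q := (p ^ f)%N.

Let q_gt1 : (1 < q)%N.
Proof. by rewrite -(expn0 p) ltn_exp2l // prime_gt1 // (pcharf_prime charE). Qed.

(* If [gamma ^+ (q ^ r - 1) = (A r)^-1], conjugation by [gamma] makes [addpoly]
   monic; [escape_shift] is the valuation of [gamma] and [reduced_val i] that of
   the [i]-th conjugated coefficient (or [0] if this coefficient vanishes). *)
Definition escape_shift : R := - N (A r) / ((q ^ r)%:R - 1).

Definition reduced_val i : R :=
  if A i == 0 then 0 else N (A i) + ((q ^ i)%:R - 1) * escape_shift.

(** A crude choice: the sum of all absolute values suffices because [q^r - q^i >= 1] for [i < r],
    and it vanishes when all [reduced_val i] do. *)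
Definition escape_radius : R := - \sum_(i < r) `|reduced_val i|.

Lemma escape_radius_le0 : escape_radius <= 0.
Proof. by rewrite oppr_le0 sumr_ge0. Qed.

Lemma escape_shiftE : (0 < r)%N -> ((q ^ r)%:R - 1) * escape_shift = - N (A r).
Proof.
move=> r_gt0; rewrite mulrC divfK // subr_eq0 pnatr_eq1.
by rewrite -(expn0 q) eqn_exp2l // eqn0Ngt r_gt0.
Qed.

Lemma escape_radiusP i : (i < r)%N -> A i != 0 ->
  ((q ^ r)%:R - (q ^ i)%:R) * escape_radius
    <= N (A i) + ((q ^ i)%:R - 1) * escape_shift.
Proof.
move=> ir Ai.
have qir : 1 <= (q ^ r)%:R - (q ^ i)%:R :> R.
  by rewrite -natrB ?leq_exp2l ?(ltnW ir) // ler1n subn_gt0 ltn_exp2l.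
have le1 : escape_radius <= - `|reduced_val i|.
  by rewrite lerN2 (bigD1 (Ordinal ir)) //= lerDl sumr_ge0.
have : ((q ^ r)%:R - (q ^ i)%:R) * escape_radius <= 1 * escape_radius.
  by rewrite ler_wnM2r // escape_radius_le0.
have [h _] := norm_range (reduced_val i).
have : reduced_val i = N (A i) + ((q ^ i)%:R - 1) * escape_shift.
  by rewrite /reduced_val (negbTE Ai).
by lra.
Qed.

Lemma minval_escape z : (0 < r)%N -> z != 0 ->
  N z - escape_shift < escape_radius ->
  addpoly p f r A z != 0 /\
  N (addpoly p f r A z) - escape_shift = (q ^ r)%:R * (N z - escape_shift).
Proof.
move=> r_gt0 z0; apply: addpoly_escape => //.
- exact: escape_shiftE.
- exact: escape_radius_le0.
- exact: escape_radiusP.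
Qed.

(** Far below 0 the leading term dominates and the two quantities differ by [N (A r)]; elsewhere
    both are bounded. For [r = 0] the map is multiplication by a constant. *)
Lemma minval_addpoly :
  exists B, forall z, `|minval (addpoly p f r A z) - (q ^ r)%:R * minval z| <= B.
Proof.
have [r0|r_gt0] := posnP r.
  exists `|N (A r)| => z; rewrite /addpoly r0 big_ord1 /= !expn0 expr1 mul1r.
  rewrite /minval mulf_eq0; have := Ar_neq0; rewrite r0 => A0.
  rewrite (negbTE A0) /=; case: ifP => [_|/negbT z0]; first by rewrite subrr normr0.
  rewrite (rvalM NP) //; have [] := norm_range (N (A 0%N)).
  set a := N (A 0%N); set x := N z => h1 h2; rewrite ler_norml.
  by case: (lerP 0 x) => hx; case: (lerP 0 (a + x)) => hax; lra.
have Q0 : 0 <= (q ^ r)%:R :> R by exact: ler0n.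
(* The absolute value of [g] is subtracted so that [N z < M] implies the escape condition on
   [N z - g]. *)
pose g := escape_shift; pose M := escape_radius - `|g|.
have M0 : M <= 0.
  by rewrite /M; have := escape_radius_le0; have := normr_ge0 g; lra.
pose c := - \sum_(i < r.+1) `|N (A i)|.
have c0 : c <= 0 by rewrite oppr_le0 sumr_ge0.
exists (- c - 2 * (q ^ r)%:R * M + `|N (A r)|) => z.
have QM0 : (q ^ r)%:R * M <= 0 by rewrite mulr_ge0_le0.
have NA0 := normr_ge0 (N (A r)).
have [->|z0] := eqVneq z 0.
  rewrite (addpoly0 f r A charE) /minval eqxx mulr0 subrr normr0; lra.
have [zM|Mz] := ltP (N z) M.
  have [|w0] := minval_escape r_gt0 z0.
    by have [_] := norm_range g; move: zM; rewrite /M -/g; have := norm_range (- g);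
       rewrite normrN => -[h1 h2]; lra.
  have := escape_shiftE r_gt0; rewrite -/g => hg hw.
  have {}hw : N (addpoly p f r A z) = (q ^ r)%:R * N z + N (A r).
    have -> : N (A r) = - (((q ^ r)%:R - 1) * g) by rewrite hg opprK.
    by move: hw; set Q := (q ^ r)%:R; lra.
  rewrite /minval (negbTE z0) (negbTE w0) hw.
  have [] := norm_range (N (A r)); set a := N (A r) => h1 h2.
  have QN0 : (q ^ r)%:R * N z <= 0.
    by rewrite mulr_ge0_le0 // (le_trans _ M0) // ltW.
  have Nz0 : N z <= 0 by rewrite (le_trans _ M0) // ltW.
  rewrite ler_norml (min_idPr Nz0).
  by case: (lerP 0 ((q ^ r)%:R * N z + a)) => h; lra.
have hA : vge N (c + (q ^ r)%:R * M) (addpoly p f r A z).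
  apply: vge_sum => // i _; have [->|Ai] := eqVneq (A i) 0.
    by left; rewrite mul0r.
  apply: vgeM => //.
    right; rewrite /c (bigD1 i) //= opprD.
    have [h _] := norm_range (N (A i)).
    apply: le_trans h; rewrite gerDl oppr_le0; exact: sumr_ge0.
  right; rewrite (rvalX NP) //.
  apply: le_trans (_ : (q ^ i)%:R * M <= _); last by rewrite ler_wpM2l ?ler0n.
  by rewrite ler_wnM2r // ler_nat leq_exp2l // -ltnS.
have h1 : c + (q ^ r)%:R * M <= minval (addpoly p f r A z).
  rewrite /minval; case: ifP => [_|/negbT w0]; first by lra.
  by rewrite le_min (vge_neq0 w0 hA) andbT; lra.
have h2 := minval_le0 (addpoly p f r A z).
have h3 : (q ^ r)%:R * M <= (q ^ r)%:R * minval z.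
  by rewrite ler_wpM2l // /minval (negbTE z0) le_min M0 Mz.
have h4 : (q ^ r)%:R * minval z <= 0 by rewrite mulr_ge0_le0 // minval_le0.
by rewrite ler_norml; lra.
Qed.

End Crude.

(** * Canonical local heights as limits along an orbit *)

Section Limit.
Variables (Phi : E -> E) (D : nat) (B : R).
Hypothesis D_gt1 : (1 < D)%N.
Hypothesis minval_Phi : forall z, `|minval (Phi z) - D%:R * minval z| <= B.

Definition orbit_minval z n : R := minval (iter n Phi z) / (D ^ n)%:R.

Definition lheight z : R := - limn (orbit_minval z).

Let DX_gt0 n : 0 < (D ^ n)%:R :> R.
Proof. by rewrite ltr0n expn_gt0 (ltn_trans _ D_gt1). Qed.

Let B_ge0 : 0 <= B.
Proof. exact: le_trans (normr_ge0 _) (minval_Phi 0). Qed.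

(** The increment is at most [B / D^(n+1)]. Since [D >= 2], the telescoping right side dominates it,
    so the sequence becomes monotone after adding or subtracting [B / D^n]. *)
Let orbit_minval_step z n :
  `|orbit_minval z n.+1 - orbit_minval z n| <= B / (D ^ n)%:R - B / (D ^ n.+1)%:R.
Proof.
have Dn := DX_gt0 n; have Dn1 := DX_gt0 n.+1.
have D0 : (0 : R) < D%:R by rewrite ltr0n (ltn_trans _ D_gt1).
have D2 : (2 : R) <= D%:R by rewrite ler_nat.
have e1 : orbit_minval z n.+1 - orbit_minval z n
    = (minval (Phi (iter n Phi z)) - D%:R * minval (iter n Phi z)) / (D ^ n.+1)%:R.
  rewrite /orbit_minval iterS expnS natrM; field.
  by rewrite !lt0r_neq0.
have e2 : B / (D ^ n)%:R - B / (D ^ n.+1)%:R = (D%:R - 1) * B / (D ^ n.+1)%:R.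
  by rewrite expnS natrM; field; rewrite !lt0r_neq0.
rewrite e1 e2 normrM normfV (gtr0_norm Dn1) ler_pM2r ?invr_gt0 //.
apply: le_trans (minval_Phi _) _.
by rewrite ler_peMl //; lra.
Qed.

Let lo z : {homo (fun n => orbit_minval z n - B / (D ^ n)%:R) : n m / (n <= m)%N >-> n <= m}.
Proof.
apply/nondecreasing_seqP => n; have := orbit_minval_step z n.
by rewrite ler_norml => /andP [h _]; lra.
Qed.

Let hi z : {homo (fun n => orbit_minval z n + B / (D ^ n)%:R) : n m / (n <= m)%N >-> m <= n}.
Proof.
apply/nonincreasing_seqP => n; have := orbit_minval_step z n.
by rewrite ler_norml => /andP [_ h]; lra.
Qed.

Let orbit_minval_range z n : minval z - B <= orbit_minval z n <= minval z + B.
Proof.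
have := @lo z 0%N n isT; have := @hi z 0%N n isT.
rewrite /orbit_minval !expn0 !divr1 /=.
have : 0 <= B / (D ^ n)%:R by rewrite divr_ge0 // ltW.
by lra.
Qed.

Lemma orbit_minval_cvg z : cvgn (orbit_minval z).
Proof.
have cB : cvgn (fun n => B / (D ^ n)%:R).
  apply: nonincreasing_is_cvgn.
    apply/nonincreasing_seqP => n.
    by have := le_trans (normr_ge0 _) (orbit_minval_step z n); lra.
  by exists 0 => _ [n _ <-]; rewrite divr_ge0 // ltW.
have cl : cvgn (fun n => orbit_minval z n - B / (D ^ n)%:R).
  apply: nondecreasing_is_cvgn => //.
  exists 0 => _ [n _ <-].
  have h1 : orbit_minval z n <= 0.
    by rewrite mulr_le0_ge0 ?minval_le0 // invr_ge0 ltW.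
  by rewrite subr_le0; apply: le_trans h1 _; rewrite divr_ge0 // ltW.
have -> : orbit_minval z
    = (fun n => orbit_minval z n - B / (D ^ n)%:R) \+ (fun n => B / (D ^ n)%:R).
  by apply/funext => n; rewrite /GRing.add_fun /= subrK.
exact: is_cvgD cl cB.
Qed.

Lemma lheight_near z : `|lheight z + minval z| <= B.
Proof.
have c : cvgn (orbit_minval z) := @orbit_minval_cvg z.
have h1 : minval z - B <= limn (orbit_minval z).
  by apply: limr_ge => //; apply: nearW => n; case/andP: (orbit_minval_range z n).
have h2 : limn (orbit_minval z) <= minval z + B.
  by apply: limr_le => //; apply: nearW => n; case/andP: (orbit_minval_range z n).
by rewrite ler_norml /lheight; lra.
Qed.

Lemma lheight_ge0 z : 0 <= lheight z.
Proof.
rewrite oppr_ge0; apply: limr_le; first exact: orbit_minval_cvg.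
apply: nearW => n; rewrite mulr_le0_ge0 ?minval_le0 // invr_ge0 ltW //.
Qed.

Lemma lheight_Phi z : lheight (Phi z) = D%:R * lheight z.
Proof.
rewrite /lheight mulrN; congr (- _); apply: cvg_lim => //.
have h : (orbit_minval z n.+1 @[n --> \oo] --> limn (orbit_minval z))%classic.
  by rewrite cvg_shiftS; apply: orbit_minval_cvg.
have -> : orbit_minval (Phi z)
    = (fun=> D%:R) \* (fun n => orbit_minval z n.+1).
  apply/funext => n; rewrite /GRing.mul_fun /= /orbit_minval -iterSr expnS.
  by rewrite natrM; field; rewrite !lt0r_neq0 // ltr0n (ltn_trans _ D_gt1).
exact: cvgM (cvg_cst _) h.
Qed.

Lemma lheight_iter n z : lheight (iter n Phi z) = (D ^ n)%:R * lheight z.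
Proof.
elim: n => [|n IHn]; first by rewrite expn0 mul1r.
by rewrite iterS lheight_Phi IHn expnS natrM mulrA.
Qed.

(* Both sides scale by [D] under [Phi], and their difference is bounded. *)
Lemma lheight_commute (T : E -> E) (Dt : nat) (Bt : R) z :
  (forall y, T (Phi y) = Phi (T y)) ->
  (forall y, `|minval (T y) - Dt%:R * minval y| <= Bt) ->
  lheight (T z) = Dt%:R * lheight z.
Proof.
move=> TP hT.
have iTP n y : T (iter n Phi y) = iter n Phi (T y).
  by elim: n => //= n IHn; rewrite TP IHn.
have bnd y : `|lheight (T y) - Dt%:R * lheight y| <= B + Bt + Dt%:R * B.
  have -> : lheight (T y) - Dt%:R * lheight y = (lheight (T y) + minval (T y))
    - (minval (T y) - Dt%:R * minval y) - Dt%:R * (lheight y + minval y).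
    by ring.
  apply: le_trans (ler_normB _ _) _; apply: lerD.
    by apply: le_trans (ler_normB _ _) _; apply: lerD => //; apply: lheight_near.
  by rewrite normrM normr_nat ler_wpM2l ?ler0n // lheight_near.
apply/eqP; rewrite -subr_eq0 -normr_le0 -oppr_ge0.
apply: (@geometric_ge0 D _ (B + Bt + Dt%:R * B)) => // k.
rewrite mulrN lerN2; have := bnd (iter k Phi z).
rewrite iTP !lheight_iter; congr (_ <= _).
have -> : (D ^ k)%:R * lheight (T z) - Dt%:R * ((D ^ k)%:R * lheight z)
  = (D ^ k)%:R * (lheight (T z) - Dt%:R * lheight z) by ring.
by rewrite normrM normr_nat.
Qed.

(** * Points of very negative valuation have large local height *)

Section Escape.
Variables (p f r : nat) (A : nat -> E).
Hypothesis charE : p \in [pchar E].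
Hypotheses (f_gt0 : (0 < f)%N) (r_gt0 : (0 < r)%N) (Ar_neq0 : A r != 0).
Hypothesis comm : forall y, addpoly p f r A (Phi y) = Phi (addpoly p f r A y).

Lemma lheight_addpoly z :
  lheight (addpoly p f r A z) = ((p ^ f) ^ r)%:R * lheight z.
Proof.
have [Bt hBt] := minval_addpoly charE f_gt0 Ar_neq0.
exact: (lheight_commute _ comm hBt).
Qed.

Lemma lheight_iter_addpoly k z : lheight (iter k (addpoly p f r A) z)
  = (((p ^ f) ^ r) ^ k)%:R * lheight z.
Proof.
elim: k => [|k IHk]; first by rewrite expn0 mul1r.
by rewrite iterS lheight_addpoly IHk expnS natrM mulrA.
Qed.

(** Below the radius, both [N z - escape_shift] and the height are multiplied by [q^r] at each step,
    with [q = p^f]. The height is at least minus the valuation up to a bounded error, which scaling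
    removes. *)
Lemma lheight_escape z : z != 0 ->
  escape_radius p f r A - lheight z <= N z - escape_shift p f r A.
Proof.
move=> z0; have lh0 := lheight_ge0 z; set g := escape_shift _ _ _ _.
have [|ltz] := leP (escape_radius p f r A) (N z - g); first by lra.
have Q1 : (1 < (p ^ f) ^ r)%N.
  rewrite -expnM -(expn0 p) ltn_exp2l ?muln_gt0 ?f_gt0 //.
  exact: prime_gt1 (pcharf_prime charE).
have it k : iter k (addpoly p f r A) z != 0 /\
  N (iter k (addpoly p f r A) z) - g = (((p ^ f) ^ r) ^ k)%:R * (N z - g).
  elim: k => [|k [k0 IHk]]; first by rewrite expn0 mul1r.
  have [|w0 wE] := minval_escape charE f_gt0 Ar_neq0 r_gt0 k0.
    rewrite IHk; apply: (le_lt_trans _ ltz).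
    have M0 := le_trans (ltW ltz) (escape_radius_le0 p f r A).
    by apply: ler_neMl => //; rewrite ler1n expn_gt0 (ltn_trans _ Q1).
  by rewrite iterS w0 wE IHk expnS natrM mulrA.
suff : 0 <= lheight z + (N z - g).
  by have := escape_radius_le0 p f r A; lra.
apply: (@geometric_ge0 _ _ (g + B) Q1) => k.
have [k0 kE] := it k; rewrite mulrDr -kE -lheight_iter_addpoly.
have := lheight_near (iter k (addpoly p f r A) z).
rewrite ler_norml => /andP [h _]; move: h.
rewrite /minval (negbTE k0); set w := N _.
have : Num.min 0 w <= w by rewrite ge_min lexx orbT.
by lra.
Qed.

End Escape.
End Limit.
End LocalHeight.

(** * Lower bound for the sum of the local heights *)

(** [i0] is the greatest index attaining the minimum, so that later values are strictly larger;
    [delta] is the least of these gaps and of [- a i0]. *)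
Lemma exists_last_min (R : realFieldType) (P : pred nat) (a : nat -> R) (r' i : nat) :
  (i < r')%N -> P i -> a i < 0 ->
  exists i0 delta, [/\ (i0 < r')%N, P i0, 0 < delta, a i0 <= - delta
    & forall k, (i0 < k < r')%N -> P k -> a i0 + delta <= a k].
Proof.
move=> ir Pi ai.
case: (@arg_minP _ _ _ (Ordinal ir) (fun k : 'I_r' => P k) (fun k : 'I_r' => a k) Pi).
move=> i1 Pi1 min1.
have P1 : P i1 && (a i1 == a i1) by rewrite Pi1 eqxx.
case: (@arg_maxnP _ i1 (fun k : 'I_r' => P k && (a k == a i1)) (fun k => val k) P1).
move=> i0 /andP [Pi0 /eqP ai0] max0.
have lt0 : a i0 < 0 by rewrite ai0; apply: le_lt_trans ai; apply: (min1 (Ordinal ir)).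
pose delta := \big[Num.min/(- a i0)]_(k < r' | P k && (i0 < k)%N) (a k - a i0).
exists i0, delta; split => //.
- rewrite /delta; elim/big_ind: _ => [|x y hx hy|k /andP [Pk i0k]].
  + by rewrite oppr_gt0.
  + by rewrite lt_min hx hy.
  rewrite subr_gt0 ai0 lt_neqAle (min1 k Pk) andbT.
  apply/eqP => e; have := max0 k; rewrite Pk e eqxx => /(_ isT) /=.
  by rewrite leqNgt i0k.
- rewrite lerNr; rewrite /delta; elim/big_rec: _ => // k x _ h.
  by rewrite ge_min h orbT.
- move=> k /andP [i0k kr] Pk; rewrite -lerBrDl /delta.
  rewrite (bigD1 (Ordinal kr)) /=; last by rewrite Pk.
  by rewrite ge_min lexx.
Qed.

(** For the exponent [h + h] one has [p^(h+h) >= (h+1)^2], which is quadratic in [h]. *)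
Lemma exp_beats_linear (R : realType) (p n0 : nat) (a b c : R) :
  (1 < p)%N -> 0 < a ->
  exists n, (n0 < n)%N /\ b * n.+1%:R + c < a * (p ^ n)%:R.
Proof.
move=> p1 a0; pose X := (2 * `|b| + `|c|) / a.
have X0 : 0 <= X.
  by rewrite divr_ge0 ?(ltW a0) // addr_ge0 ?mulr_ge0 // normr_ge0.
pose h := (Num.bound X + n0).+1; exists (h + h)%N; split.
  by rewrite /h; lia.
have hX : 2 * `|b| + `|c| < a * h.+1%:R.
  rewrite -ltr_pdivrMl // mulrC -/X; apply: lt_le_trans (archi_boundP X0) _.
  by rewrite ler_nat /h; lia.
have hp : (h.+1 * h.+1 <= p ^ (h + h))%N.
  by rewrite expnD leq_mul // ltn_expl.
have : (h.+1 * h.+1)%:R <= (p ^ (h + h))%:R :> R by rewrite ler_nat.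
rewrite natrM; set H : R := h.+1%:R in hX *; set Q : R := (p ^ _)%:R => hQ.
have H1 : 1 <= H by rewrite ler1n.
clearbody h.
have hn : (h + h).+1%:R = 2 * H - 1 by rewrite /H -!natr1 natrD; ring.
rewrite hn.
have [_ hb] := norm_range b; have [_ hc] := norm_range c.
have b0 := normr_ge0 b; have c0 := normr_ge0 c.
apply: lt_le_trans (_ : a * (H * H) <= _); last by rewrite ler_pM2l.
apply: le_lt_trans (_ : (2 * `|b| + `|c|) * H < _); last first.
  by rewrite mulrA ltr_pM2r // (lt_le_trans _ H1).
have h1 : b * (2 * H - 1) <= `|b| * (2 * H - 1).
  by rewrite ler_wpM2r //; lra.
have h2 : `|c| <= `|c| * H by rewrite ler_peMr.
by lra.
Qed.

(** * Real-valued valuations of [p]-power roots *)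

Section RealValuationOf.
Variables (R : realType) (K : fieldType) (p : nat).
Hypothesis p_gt0 : (0 < p)%N.
Implicit Type v : K -> \bar int.

(* The valuation of the [p^m]-th root of [x]. *)
Definition root_val m v (x : K) : R := val_real R (v x) / (p ^ m)%:R.

Lemma valuation_fin v x : is_valuation v -> x != 0 -> v x = (fine (v x))%:E.
Proof.
move=> [vN v0 _ _ _] x0; have := vN x; have := v0 x.
by case: (v x) => //= [[/(_ erefl) /eqP]]; rewrite (negbTE x0).
Qed.

Lemma valuation0 v : is_valuation v -> v 0 = +oo%E.
Proof. by move=> [_ v0 _ _ _]; apply/v0. Qed.

Lemma valuation_fine_neq0 v x : is_valuation v -> x != 0 ->
  (val_real R (v x) == 0) = (v x == 0%E).
Proof.
move=> hv x0; rewrite (valuation_fin hv x0) /val_real /= intr_eq0 //.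
Qed.

Lemma root_val_real_valuation m v : is_valuation v ->
  real_valuation (root_val m v).
Proof.
move=> hv; have [vN v0 vM vD v1] := hv; split => x y x0 y0.
  rewrite /root_val vM (valuation_fin hv x0) (valuation_fin hv y0) /val_real /=.
  by rewrite intrD mulrDl.
move=> xy0; have := vD x y; rewrite (valuation_fin hv x0) (valuation_fin hv y0).
rewrite (valuation_fin hv xy0) -EFin_min lee_fin => h.
rewrite /root_val /val_real -minr_pMl ?invr_ge0 ?ler0n //.
rewrite ler_pM2r ?invr_gt0 ?ltr0n ?expn_gt0 ?p_gt0 //.
move: h; rewrite !ge_min => /orP [] h; apply/orP; [left|right].
  by rewrite (valuation_fin hv x0) (valuation_fin hv xy0) /= ler_int.
by rewrite (valuation_fin hv y0) (valuation_fin hv xy0) /= ler_int.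
Qed.

(** Hence raising coefficients to the power [p^m] while passing to roots leaves their valuations
    unchanged. *)
Lemma root_val_exp m v x : is_valuation v -> x != 0 ->
  root_val m v (x ^+ (p ^ m)) = val_real R (v x).
Proof.
move=> hv x0.
have h0 : real_valuation (root_val 0 v) := root_val_real_valuation 0 hv.
have := rvalX h0 (p ^ m) x0; rewrite /root_val expn0 !divr1 => ->.
by rewrite mulrC mulKf // pnatr_eq0 expn_eq0 eqn0Ngt p_gt0.
Qed.

End RealValuationOf.

(** * Summation over all places with the product formula *)

Section Global.
Variables (R : realType) (K : fieldType) (p f r : nat).
Hypotheses (charK : p \in [pchar K]) (f_gt0 : (0 < f)%N) (r_gt0 : (0 < r)%N).
Variables (U : set (K -> \bar int)) (d : (K -> \bar int) -> R).
Hypothesis U_good : good_set U d.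
Variable A : nat -> K.
Hypothesis Ar_neq0 : A r != 0.
Let q := (p ^ f)%N.
Let Dr := (q ^ r)%N.
Let p_prime := pcharf_prime charK.
Let p_gt0 := prime_gt0 p_prime.

Implicit Type v : K -> \bar int.

Definition place_shift v : R := escape_shift (root_val R p 0 v) p f r A.
Definition place_radius v : R := escape_radius (root_val R p 0 v) p f r A.
Definition place_slope v i : R := reduced_val (root_val R p 0 v) p f r A i.

(** The [p^m]-th power of the value of the polynomial at [y] is the value at [c = y^(p^m)] of the
    polynomial with these coefficients; points of the perfect closure are thus treated inside
    [K]. *)
Let frobA m i := A i ^+ (p ^ m).

Let U_val v : U v -> is_valuation v.
Proof. by case: U_good => h _ _ _; apply: h. Qed.

Let d_gt0 v : U v -> 0 < d v.
Proof. by case: U_good => _ h _ _; apply: h. Qed.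

Lemma root_val0E v x : root_val R p 0 v x = val_real R (v x).
Proof. by rewrite /root_val expn0 divr1. Qed.

(** Independence of [m], here and in the next two lemmas, makes the final constant uniform over the
    perfect closure. *)
Lemma place_shiftE m v : U v ->
  escape_shift (root_val R p m v) p f r (frobA m) = place_shift v.
Proof.
move=> Uv; rewrite /place_shift /escape_shift root_val0E.
by rewrite (root_val_exp _ p_gt0 _ (U_val Uv)).
Qed.

Lemma place_slopeE m v i : U v ->
  reduced_val (root_val R p m v) p f r (frobA m) i = place_slope v i.
Proof.
move=> Uv; rewrite /place_slope /reduced_val (place_shiftE m Uv) /frobA.
rewrite expf_eq0 expn_gt0 p_gt0 /= root_val0E.
by case: eqVneq => // Ai; rewrite (root_val_exp _ p_gt0 _ (U_val Uv)).
Qed.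

Lemma place_radiusE m v : U v ->
  escape_radius (root_val R p m v) p f r (frobA m) = place_radius v.
Proof.
move=> Uv; rewrite /place_radius /escape_radius; congr (- _).
by apply: eq_bigr => i _; rewrite place_slopeE.
Qed.

Definition coef_places : set (K -> \bar int) :=
  \bigcup_(i in `I_r.+1) [set v | [/\ U v, A i != 0 & v (A i) != 0%E]].

Lemma finite_coef_places : finite_set coef_places.
Proof.
apply: bigcup_finite => // i _; have [Ai|Ai] := eqVneq (A i) 0.
  by apply: (sub_finite_set _ (@finite_set0 _)) => v [].
have [_ _ /(_ _ Ai) h _] := U_good; apply: sub_finite_set h => v [Uv _ nv].
by split.
Qed.

Lemma coef_places_trivial v i : U v -> ~ coef_places v -> (i <= r)%N ->
  A i != 0 -> val_real R (v (A i)) = 0.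
Proof.
move=> Uv nT ir Ai; apply/eqP; rewrite (valuation_fine_neq0 _ (U_val Uv) Ai).
apply/negPn/negP => nv; apply: nT; exists i => //=.
Qed.

Lemma place_shift_trivial v : U v -> ~ coef_places v -> place_shift v = 0.
Proof.
move=> Uv nT; rewrite /place_shift /escape_shift root_val0E.
by rewrite (coef_places_trivial Uv nT) // oppr0 mul0r.
Qed.

Lemma place_slope_trivial v i : U v -> ~ coef_places v -> (i <= r)%N ->
  place_slope v i = 0.
Proof.
move=> Uv nT ir; rewrite /place_slope /reduced_val; case: eqVneq => // Ai.
rewrite -/(place_shift v) (place_shift_trivial Uv nT) mulr0 addr0 root_val0E.
exact: coef_places_trivial.
Qed.

Lemma place_radius_trivial v : U v -> ~ coef_places v -> place_radius v = 0.
Proof.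
move=> Uv nT; rewrite /place_radius /escape_radius big1 ?oppr0 // => i _.
rewrite -/(place_slope v i) (place_slope_trivial Uv nT) ?normr0 //.
exact: ltnW.
Qed.

Lemma sum_place (T : set (K -> \bar int)) (F : (K -> \bar int) -> R) :
  T `<=` U -> (forall v, U v -> ~ T v -> F v = 0) ->
  \sum_(v \in T) d v * F v = \sum_(v \in U) d v * F v.
Proof.
move=> TU F0; apply: fsbig_widen => // v [Uv nT] /=.
by rewrite F0 // mulr0.
Qed.

Lemma product_formula (T : set (K -> \bar int)) x : T `<=` U -> x != 0 ->
  (forall v, U v -> ~ T v -> val_real R (v x) = 0) ->
  \sum_(v \in T) d v * val_real R (v x) = 0.
Proof. by move=> TU x0 h; rewrite sum_place //; case: U_good => _ _ _; apply. Qed.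

(* [lam v] stands for the local height at [v], of which only the properties
   listed as hypotheses matter. *)
Theorem sum_local_heights v0 i :
  U v0 -> (i < r)%N -> A i != 0 -> place_slope v0 i < 0 ->
  exists2 C : R, 0 < C & forall m x (lam : (K -> \bar int) -> K -> R),
    (forall n, pfree (orbit_seq p f r (frobA m) n x)) ->
    (forall v z, U v -> 0 <= lam v z) ->
    (forall v k, U v -> lam v (iter k (addpoly p f r (frobA m)) x)
        = (Dr ^ k)%:R * lam v x) ->
    (forall v z, U v -> z != 0 ->
        place_radius v - lam v z <= root_val R p m v z - place_shift v) ->
    exists T, [/\ finite_set T, T `<=` U
      & C < \sum_(v \in T) d v * lam v x].
Proof.
move=> Uv0 ir Ai ai.
pose a k := place_slope v0 k.
have [i0 [delta [i0r Ai0 delta0 ai0 alast]]] :=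
  @exists_last_min R (fun k => A k != 0) a r.+1 i (leqW ir) Ai ai.
have q1 : (1 < q)%N by rewrite -(expn0 p) ltn_exp2l // prime_gt1.
have aE k : A k != 0 -> a k = val_real R (v0 (A k)) + ((q ^ k)%:R - 1) * place_shift v0.
  by move=> Ak; rewrite /a /place_slope /reduced_val (negbTE Ak) root_val0E.
(* The conjugate is monic, so its top slope is 0 and the negative minimum lies at an index below
   [r]. *)
have ar : a r = 0.
  have h : ((q ^ r)%:R - 1) * place_shift v0 = - root_val R p 0 v0 (A r).
    by apply: escape_shiftE.
  by rewrite aE // h root_val0E subrr.
have {}i0r : (i0 < r)%N.
  rewrite ltn_neqAle -ltnS i0r andbT; apply/eqP => e.
  by move: ai0; rewrite e ar; lra.
have Q1 : 1 <= (q ^ r)%:R :> R by rewrite ler1n expn_gt0 (ltn_trans _ q1).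
have Q0 : 0 < (q ^ r)%:R :> R by exact: lt_le_trans Q1.
(* Half of the gap [delta] pays for the terms [q^k s0] with [k <= r]; the other half is [m0]. *)
pose s0 := delta / 2 / (q ^ r)%:R; pose m0 := delta / 2.
have s0_gt0 : 0 < s0 by rewrite !divr_gt0.
have m0_gt0 : 0 < m0 by rewrite divr_gt0.
have Qs0 k : (k <= r)%N -> (q ^ k)%:R * s0 <= delta / 2.
  move=> kr; have -> : (q ^ k)%:R * s0 = m0 * ((q ^ k)%:R / (q ^ r)%:R).
    by rewrite /s0 /m0; ring.
  apply: ler_piMr; first exact: ltW.
  by rewrite ler_pdivrMr // mul1r ler_nat leq_exp2l.
have s0m0 : s0 <= m0 by have := Qs0 0%N isT; rewrite expn0 mul1r.
pose kap := Num.min s0 (m0 / (p ^ (f * i0).+1)%:R).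
have kap0 : 0 < kap.
  by rewrite lt_min s0_gt0 divr_gt0 // ltr0n expn_gt0 p_gt0.
pose mu := - \sum_(v \in U) d v * place_radius v.
have d0 := d_gt0 Uv0.
(* The gain [d v0 * kap * p^n] is made larger than the linear loss from the radii, the constant loss
   at [v0] and the 1 allowed to the heights. This [n] depends neither on [m] nor on [x]. *)
have [n [n_gt n_big]] := @exp_beats_linear R p (f * i0) (d v0 * kap)
  (Dr%:R * mu) (1 + d v0 * (s0 * (p ^ (f * i0))%:R)) (prime_gt1 p_prime)
  (mulr_gt0 d0 kap0).
(* [W] is the factor of the total height in the final inequality, so that a total of at most [W^-1]
   costs at most 1. *)
pose W : R := n.+1%:R * Dr%:R * (Dr ^ (n + n))%:R.
have Dr_gt0 : (0 < Dr)%N by rewrite expn_gt0 (ltn_trans _ q1).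
have W0 : 0 < W by rewrite !mulr_gt0 // ltr0n // expn_gt0 Dr_gt0.
exists W^-1; first by rewrite invr_gt0.
move=> m x lam fx lam0 lamk lamesc.
pose N v := root_val R p m v.
have NP v : U v -> real_valuation (N v).
  by move=> Uv; apply: root_val_real_valuation => //; apply: U_val.
have mAr : frobA m r != 0 by rewrite expf_neq0.
(* An error that serves for all iterates up to [n + n], by the scaling of [lam] and the escape
   inequality. *)
pose b v := (Dr ^ (n + n))%:R * lam v x - place_radius v.
have rad0 v : place_radius v <= 0 by apply: escape_radius_le0.
have b0 v : U v -> 0 <= b v.
  by move=> Uv; rewrite subr_ge0 (le_trans (rad0 v)) // mulr_ge0 ?ler0n ?lam0.
have hx v : U v -> forall k, (k <= n + n)%N ->
    vge (N v) (place_shift v - b v) (iter k (addpoly p f r (frobA m)) x).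
  move=> Uv k kn; set z := iter _ _ _.
  have [->|z0] := eqVneq z 0; first by left.
  right; have := lamesc v z Uv z0; rewrite lamk // -/(N v) /b.
  have : (Dr ^ k)%:R * lam v x <= (Dr ^ (n + n))%:R * lam v x.
    by rewrite ler_wpM2r ?lam0 // ler_nat leq_pexp2l.
  by lra.
have hg v : U v -> ((q ^ r)%:R - 1) * place_shift v = - N v (frobA m r).
  by move=> Uv; rewrite -(place_shiftE m Uv); apply: escape_shiftE.
have slopeE k : A k != 0 ->
    N v0 (frobA m k) + ((q ^ k)%:R - 1) * place_shift v0 = a k.
  by move=> Ak; rewrite aE // /N (root_val_exp _ p_gt0 _ (U_val Uv0)).
have mA k : (frobA m k != 0) = (A k != 0).
  by rewrite expf_eq0 expn_gt0 p_gt0.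
have [H [sH fH spH hH]] := @exists_moore_bad K p f r (frobA m) charK f_gt0 r_gt0
  mAr R (N v0) (NP v0 Uv0) (place_shift v0) (hg v0 Uv0) i0 s0 m0 i0r
  (eq_ind_r is_true Ai0 (mA i0)) s0_gt0 m0_gt0
  (ltac:(by rewrite slopeE //; rewrite /m0 in s0m0 *; lra))
  (ltac:(move=> k /andP [i0k kr]; rewrite mA => Ak; rewrite !slopeE //;
         have := alast k; rewrite i0k ltnS kr => /(_ isT Ak);
         have := Qs0 k kr; rewrite /m0; lra))
  n x (b v0) n_gt (b0 v0 Uv0) (hx v0 Uv0) (fx n.+1).
rewrite -/kap in hH.
have D0 := moore_neq0 charK fH.
(* A finite set outside which the determinant, the coefficients, the shifts and the radii contribute
   nothing. *)
pose T := [set v | U v /\ v (moore p H) != 0%E] `|` coef_places `|` [set v0].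
have TU : T `<=` U.
  by move=> v [[[]|[k _ []]]|->].
have Tfin : finite_set T.
  rewrite !finite_setU; split; last exact: finite_set1.
  by split; [case: U_good => _ _ h _; apply: h | exact: finite_coef_places].
have nTc v : ~ T v -> ~ coef_places v by move=> nT Cv; apply: nT; left; right.
exists T; split => //; rewrite ltNge; apply/negP => leC.
have sumD : \sum_(v \in T) d v * val_real R (v (moore p H)) = 0.
  apply: product_formula => // v Uv nT; apply/eqP.
  rewrite (valuation_fine_neq0 _ (U_val Uv) D0); apply/negP => nv.
  by apply: nT; left; left; split => //; apply/negP.
have sumA : \sum_(v \in T) d v * val_real R (v (A r)) = 0.
  apply: product_formula => // v Uv /nTc nT.
  exact: coef_places_trivial.
have sumM : \sum_(v \in T) d v * place_radius v = - mu.
  rewrite /mu opprK; apply: sum_place => // v Uv /nTc nT.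
  exact: place_radius_trivial.
pose S : R := \sum_(k < n) (p ^ k)%:R.
have Tv0 : T v0 by right.
(* Away from [v0] this is the orbit bound for [H]; at [v0] it is the bound of [exists_moore_bad].
   Summed over [T], the right side vanishes. *)
have bound v : T v -> d v * (S * place_shift v)
     - n.+1%:R * Dr%:R * (Dr ^ (n + n))%:R * (d v * lam v x)
     + n.+1%:R * Dr%:R * (d v * place_radius v)
     + (if v == v0 then d v0 * (kap * (p ^ n)%:R - s0 * (p ^ (f * i0))%:R) else 0)
   <= d v * val_real R (v (moore p H)) / (p ^ m)%:R.
  move=> Tv; have Uv := TU _ Tv; have dv := d_gt0 Uv.
  rewrite -[d v * val_real _ _ / _]mulrA -/(root_val R p m v (moore p H)).
  have n1D0 : 0 <= n.+1%:R * Dr%:R * b v by rewrite !mulr_ge0 ?ler0n ?b0.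
  have [vE|nv] := eqVneq v v0.
    rewrite vE in dv n1D0 *.
    have : d v0 * (S * place_shift v0 + kap * (p ^ n)%:R
        - s0 * (p ^ (f * i0))%:R - n.+1%:R * Dr%:R * b v0)
        <= d v0 * root_val R p m v0 (moore p H).
      rewrite ler_pM2l //; apply: le_trans hH.
      by rewrite /S mulr_suml.
    by rewrite /b; lra.
  have := @vge_moore_orbit K p f r (frobA m) charK f_gt0 r_gt0 mAr R (N v) (NP v Uv)
    (place_shift v) (hg v Uv) H x n (b v) (b0 v Uv) (hx v Uv) spH.
  rewrite sH => /(_ (leqnSn n)) /(vge_neq0 D0) h.
  have : d v * (S * place_shift v - n.+1%:R * Dr%:R * b v)
        <= d v * root_val R p m v (moore p H).
    rewrite ler_pM2l //; apply: le_trans h.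
    rewrite sumrB -mulr_suml -/S sumr_const card_ord -[_ *+ n]mulr_natl lerD2l lerN2.
    have hb : 0 <= (q ^ r)%:R * b v by rewrite mulr_ge0 ?ler0n ?b0.
    by rewrite -/Dr -natr1; rewrite -/Dr in hb; lra.
  by rewrite /b; lra.
pose s := finmap.enum_fset (fset_set T).
have memT v : (v \in s) = (v \in T) by rewrite /s in_fset_set.
have us : uniq s by exact: finmap.fset_uniq.
have v0s : v0 \in s by rewrite memT inE.
have sumT (F : (K -> \bar int) -> R) : \sum_(v \in T) F v = \sum_(v <- s) F v.
  exact: fsbig_finite.
rewrite !sumT in leC sumD sumA sumM.
have le0 : \sum_(v <- s) (d v * (S * place_shift v)
     - n.+1%:R * Dr%:R * (Dr ^ (n + n))%:R * (d v * lam v x)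
     + n.+1%:R * Dr%:R * (d v * place_radius v)
     + (if v == v0 then d v0 * (kap * (p ^ n)%:R - s0 * (p ^ (f * i0))%:R) else 0))
   <= 0.
  apply: (@le_trans _ _ (\sum_(v <- s) d v * val_real R (v (moore p H))
      / (p ^ m)%:R)); last by rewrite -mulr_suml sumD mul0r.
  rewrite big_seq [leRHS]big_seq; apply: ler_sum => v vs; apply: bound.
  by rewrite memT inE in vs.
move: le0; rewrite !big_split /= sumrN -!mulr_sumr sumM.
have -> : \sum_(v <- s) (if v == v0
      then d v0 * (kap * (p ^ n)%:R - s0 * (p ^ (f * i0))%:R) else 0)
    = d v0 * (kap * (p ^ n)%:R - s0 * (p ^ (f * i0))%:R).
  by rewrite (bigD1_seq v0) //= eqxx big1 ?addr0 // => v /negbTE ->.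
(* [place_shift v] is a fixed multiple of the valuation of [A r], so the product formula cancels
   it. *)
have -> : \sum_(v <- s) d v * (S * place_shift v) = 0.
  have -> : \sum_(v <- s) d v * (S * place_shift v)
      = - S / ((q ^ r)%:R - 1) * \sum_(v <- s) d v * val_real R (v (A r)).
    rewrite mulr_sumr; apply: eq_bigr => v _.
    by rewrite /place_shift /escape_shift root_val0E; ring.
  by rewrite sumA mulr0.
have : n.+1%:R * Dr%:R * (Dr ^ (n + n))%:R * \sum_(v <- s) d v * lam v x <= 1.
  by rewrite -/W mulrC -ler_pdivlMr // mul1r.
by move: n_big; lra.
Qed.

End Global.

(** * Heights over a finite extension *)

Section Extension.
Variables (R : realType) (K : fieldType) (p : nat) (L : fieldExtType K).
Hypothesis p_gt0 : (0 < p)%N.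
Implicit Types (v : K -> \bar int) (w : L -> \bar int).

Lemma ramification_unique w v e e' : is_valuation v ->
  is_ramification_index w v e -> is_ramification_index w v e' -> e = e'.
Proof.
move=> [_ _ _ _ [c vc]] [_ he] [_ he'].
by have := he c; rewrite he' vc !mule1 => -[].
Qed.

Lemma ramification_indexE w v e : is_valuation v ->
  is_ramification_index w v e -> ramification_index w v = e.
Proof.
move=> hv he; apply: xget_unique => // e' he'.
exact: ramification_unique hv he' he.
Qed.

(** On [K], [w] equals both [e v] and [e' v']; elements of value 1 show that [e] and [e'] divide
    each other. *)
Lemma extends_unique w v v' : is_valuation v -> is_valuation v' ->
  extends w v -> extends w v' -> v = v'.
Proof.
move=> hv hv' [_ [e [e0 he]]] [_ [e' [e'0 he']]].
have E x : x != 0 -> e%:Z * fine (v x) = e'%:Z * fine (v' x).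
  move=> x0; have := he x; rewrite he' (valuation_fin hv x0) (valuation_fin hv' x0).
  by move=> -[].
have dvd (u u' : K -> \bar int) a a' : is_valuation u -> is_valuation u' ->
    (forall x, x != 0 -> a%:Z * fine (u x) = a'%:Z * fine (u' x)) -> (a' %| a)%N.
  move=> hu hu' H; have [_ u0 _ _ [c uc]] := hu.
  have c0 : c != 0 by apply/eqP => /u0; rewrite uc.
  have e1 : a%:Z = a'%:Z * fine (u' c) by rewrite -(H c c0) uc /= mulr1.
  by rewrite -[a]/(absz a%:Z) e1 abszM dvdn_mulr.
have ee' : e = e'.
  apply/eqP; rewrite eqn_dvd; apply/andP; split.
    by apply: (dvd v' v) => // x x0; rewrite E.
  by apply: (dvd v v').
apply/funext => x; have [->|x0] := eqVneq x 0; first by rewrite !valuation0.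
rewrite (valuation_fin hv x0) (valuation_fin hv' x0); congr (_%:E).
have := E x x0; rewrite ee'; apply: mulfI.
by rewrite eqz_nat -lt0n.
Qed.

Lemma val_belowE w v : is_valuation v -> extends w v -> val_below w = v.
Proof.
move=> hv hw; apply: xget_unique => // v' [hv' hw'].
exact: extends_unique hv' hv hw' hw.
Qed.

(** For nonzero [c], [p^m w(z) = w(c) = e v(c)]. *)
Lemma val_real_min_root w v e m (z : L) (c : K) :
  is_valuation w -> is_valuation v -> is_ramification_index w v e ->
  z ^+ (p ^ m) = c%:A ->
  val_real R (Order.min 0%E (w z)) = e%:R * minval (root_val R p m v) c.
Proof.
move=> hw hv [e0 he] zc; rewrite /minval.
have pm0 : (p ^ m)%:R != 0 :> R by rewrite pnatr_eq0 expn_eq0 eqn0Ngt p_gt0.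
have [c0|c0] := eqVneq c 0.
  have -> : z = 0.
    by apply/eqP; move/eqP: zc; rewrite c0 scale0r expf_eq0 => /andP [].
  by rewrite (valuation0 hw) /val_real mulr0; rewrite minEle leey.
have z0 : z != 0.
  apply: contraNneq c0 => z0; move: zc; rewrite z0 expr0n expn_eq0 eqn0Ngt p_gt0 /=.
  by move/esym/eqP; rewrite scaler_eq0 oner_eq0 orbF.
have hN : real_valuation (root_val R p 0 w) := root_val_real_valuation R p_gt0 0 hw.
have := rvalX hN (p ^ m) z0; rewrite zc /root_val !expn0 !divr1.
rewrite he (valuation_fin hv c0) (valuation_fin hw z0) -EFinM -EFin_min /val_real /=.
rewrite intrM => h.
have -> : (Num.min 0 (fine (w z)))%:~R = Num.min 0 ((fine (w z))%:~R : R).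
  by rewrite !minEle -[0 in RHS](mulr0z 1) ler_int; case: ifP => //; rewrite ?mulr0z.
have -> : (fine (w z))%:~R = e%:R * ((fine (v c))%:~R / (p ^ m)%:R) :> R.
  by rewrite mulrA [e%:R]pmulrn h mulrC mulKf.
by rewrite -{1}[0](mulr0 e%:R) minr_pMr ?ler0n.
Qed.

Variables (U : set (K -> \bar int)) (d : (K -> \bar int) -> R).
Hypothesis U_good : good_set U d.
Hypothesis U_coherent : coherent U d.

Let U_val v : U v -> is_valuation v.
Proof. by case: U_good => h _ _ _; apply: h. Qed.

Let dim_gt0 : (0 < \dim {:L})%N.
Proof. by rewrite adim_gt0. Qed.

Lemma ext_set_deg w v : U v -> extends w v ->
  ext_deg d w = (residue_degree w v)%:R * d v / (\dim {:L})%:R.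
Proof. by move=> Uv hw; rewrite /ext_deg (val_belowE (U_val Uv) hw). Qed.

(** The default value 0 of [residue_degree] is excluded by the positivity of the degrees in the good
    set on [L]. *)
Lemma residue_degree_gt0 w v : U v -> extends w v -> (0 < residue_degree w v)%N.
Proof.
move=> Uv hw; have [_ /(_ L) [_ h _ _]] := U_coherent.
have := h w; rewrite (ext_set_deg Uv hw) lt0n => h'.
apply/eqP => f0; have : 0 < (0 : R); last by rewrite ltxx.
by have := h' (ex_intro2 _ _ v Uv hw); rewrite f0 !mul0r.
Qed.

Lemma ramification_gt0 w v : U v -> extends w v -> (0 < ramification_index w v)%N.
Proof.
by move=> Uv [_ [e he]]; rewrite (ramification_indexE (U_val Uv) he); case: he.
Qed.

(** A sum with infinite support is 0 by convention, whereas coherence gives the positive number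
    [[L:K]]. All terms are nonzero, so the index set is finite. *)
Lemma finite_extends v : U v -> finite_set [set w : L -> \bar int | extends w v].
Proof.
move=> Uv; have [/(_ v Uv L) h _] := U_coherent.
apply: contrapT => inf; move: dim_gt0; rewrite -h fsbig_dflt ?ltnn //.
apply: sub_infinite_set inf => w hw; split => //= /eqP.
by rewrite muln_eq0 !eqn0Ngt ramification_gt0 ?residue_degree_gt0.
Qed.

Lemma sum_ext_deg v : U v ->
  \sum_(w \in [set w : L -> \bar int | extends w v])
     ext_deg d w * (ramification_index w v)%:R = d v.
Proof.
move=> Uv; have fin := finite_extends Uv.
have [/(_ v Uv L) h _] := U_coherent; move: h.
rewrite !(fsbig_finite _ _ fin) /= => /(congr1 (fun n => n%:R : R)).
rewrite natr_sum => h.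
have dim0 : (\dim {:L})%:R != 0 :> R by rewrite pnatr_eq0 -lt0n.
apply: (mulfI dim0); rewrite -{2}h mulr_suml mulr_sumr.
rewrite big_seq [RHS]big_seq; apply: eq_bigr => w.
rewrite in_fset_set // inE /= => hw; rewrite (ext_set_deg Uv hw) natrM.
by field.
Qed.

Variables (Ar : comNzRingType) (f : nat) (tau : {rmorphism K -> K}).
Hypotheses (charK : p \in [pchar K]) (f_gt0 : (0 < f)%N).
Let q := (p ^ f)%N.
Hypothesis tauE : forall x, tau x = x ^+ q.
Variables (phi : {rmorphism Ar -> twpoly tau}) (a : Ar).
Hypothesis phia_gt0 : (0 < twdeg (phi a))%N.
Variables (m : nat) (y : L) (c : K).
Hypothesis yc : y ^+ (p ^ m) = c%:A.

Let frob (x : K) := x ^+ (p ^ m).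

Lemma tweval_root P :
  tweval q (in_alg L) P y ^+ (p ^ m) = (tweval q frob (P : twpoly tau) c)%:A.
Proof.
have charL : p \in [pchar L] by rewrite pchar_lalg.
rewrite /tweval (expr_sum_p charL) scaler_suml; apply: eq_bigr => i _.
rewrite exprMn exprAC yc -!in_algE /frob rmorphM !rmorphXn //.
Qed.

(** The part of the local height of [y] that depends only on [v], computed in [K] from
    [c = y^(p^m)]. *)
Definition root_height v : R :=
  lheight (root_val R p m v) (tweval q frob (phi a)) (q ^ twdeg (phi a))%N c.

Let q_gt1 : (1 < q)%N.
Proof. by rewrite -(expn0 p) ltn_exp2l // prime_gt1 // (pcharf_prime charK). Qed.

Let D_gt1 : (1 < q ^ twdeg (phi a))%N.
Proof. by rewrite -(expn0 q) ltn_exp2l. Qed.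

Let phia_neq0 : phi a != 0.
Proof. by apply/eqP => h; move: phia_gt0; rewrite h /twdeg size_poly0. Qed.

Let frobD : {morph frob : x y / x + y}.
Proof. by move=> x z; apply: exprDp. Qed.
Let frobM : {morph frob : x y / x * y}.
Proof. by move=> x z; apply: exprMn. Qed.
Let frob1 : frob 1 = 1.
Proof. exact: expr1n. Qed.

Lemma root_minval_bound v : U v -> exists B, forall z,
  `|minval (root_val R p m v) (tweval q frob (phi a) z)
    - (q ^ twdeg (phi a))%:R * minval (root_val R p m v) z| <= B.
Proof.
move=> Uv.
have NP : real_valuation (root_val R p m v).
  exact: root_val_real_valuation (U_val Uv).
have lead0 : frob (twcoef (phi a) (twdeg (phi a))) != 0.
  by rewrite expf_neq0 // twpoly_neq0P.
exact: (minval_addpoly NP charK f_gt0 (A := fun i => frob (twcoef (phi a) i)) lead0).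
Qed.

(** Along the whole orbit of [y], [w] is the ramification index times the root valuation of the
    orbit of [c], so the limit scales accordingly. *)
Lemma local_heightE w v : U v -> extends w v ->
  local_height q phi d a w y
    = ext_deg d w * (ramification_index w v)%:R * root_height v.
Proof.
move=> Uv [hw [e he]]; rewrite (ramification_indexE (U_val Uv) he).
have [B hB] := root_minval_bound Uv.
have cv : cvgn (orbit_minval (root_val R p m v) (tweval q frob (phi a))
    (q ^ twdeg (phi a))%N c) by apply: orbit_minval_cvg D_gt1 hB c.
rewrite /local_height /root_height /lheight -mulrA mulrN mulNr mulrN.
congr (- (_ * _)); apply: cvg_lim => //.
set u := fun n => _.
have -> : u = (fun=> e%:R) \* orbit_minval (root_val R p m v)
    (tweval q frob (phi a)) (q ^ twdeg (phi a))%N c.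
  apply/funext => n; rewrite /u /GRing.mul_fun /= /orbit_minval.
  rewrite (val_real_min_root hw (U_val Uv) he (tweval_root _)) rmorphXn /=.
  have [_ ->] := twexp_neq0 charK tauE n phia_neq0.
  rewrite (twevalX charK tauE frobD frobM frob1) -mulrA.
  by rewrite -expnM [(n * _)%N]mulnC.
exact: cvgM (cvg_cst _) cv.
Qed.

Lemma root_height_ge0 v : U v -> 0 <= root_height v.
Proof. by move=> Uv; have [B hB] := root_minval_bound Uv; apply: lheight_ge0 D_gt1 hB c. Qed.

Lemma root_height_trivial v : U v -> vge (root_val R p m v) 0 c ->
  (forall i, (i <= twdeg (phi a))%N ->
     vge (root_val R p m v) 0 (frob (twcoef (phi a) i))) ->
  root_height v = 0.
Proof.
move=> Uv hc hA; set N := root_val R p m v in hc hA *.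
have NP : real_valuation N by exact: root_val_real_valuation (U_val Uv).
have it n : vge N 0 (iter n (tweval q frob (phi a)) c).
  elim: n => //= n IHn; apply: vge_sum => // i _.
  have := vgeM NP (hA i _) (vgeX NP (q ^ i) IHn).
  by rewrite mulr0 addr0; apply; rewrite -ltnS.
rewrite /root_height /lheight.
have -> : orbit_minval N (tweval q frob (phi a)) (q ^ twdeg (phi a)) c = fun=> 0.
  apply/funext => n; rewrite /orbit_minval /minval; case: ifPn; first by rewrite mul0r.
  by move=> n0 ; rewrite (min_idPl (vge_neq0 n0 (it n))) mul0r.
by rewrite lim_cst ?oppr0.
Qed.

Lemma local_height_ge0 w : ext_set U w -> 0 <= local_height q phi d a w y.
Proof.
move=> hw; have [_ /(_ L) [_ hd _ _]] := U_coherent.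
have dw := hd w hw; case: hw => v Uv hw.
rewrite (local_heightE Uv hw); apply: mulr_ge0; last exact: root_height_ge0.
by apply: mulr_ge0 (ler0n _ _); apply: ltW.
Qed.

Hypothesis y_neq0 : y != 0.

(** If [w] is 0 at [y] and at the nonzero coefficients of [phi a], the orbit stays integral and the
    local height vanishes. *)
Lemma finite_local_height :
  finite_set [set w | ext_set U w /\ local_height q phi d a w y != 0].
Proof.
have [_ /(_ L) [Lval _ Lfin _]] := U_coherent.
pose S := [set w | @ext_set K L U w /\ w y != 0%E] `|`
  \bigcup_(i in `I_(twdeg (phi a)).+1) [set w | [/\ @ext_set K L U w,
    twcoef (phi a) i != 0 & w (twcoef (phi a) i)%:A != 0%E]].
apply: (@sub_finite_set _ _ S).
  move=> w [[v Uv hw]] /eqP nz; apply: contrapT => nS; apply: nz.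
  have ew : @ext_set K L U w by exists v.
  have hwv := Lval w ew; have hv := U_val Uv; have [_ [e [e0 he]]] := hw.
  have wy : w y = 0%E by apply/eqP/negPn/negP => h; apply: nS; left.
  have wA i : (i <= twdeg (phi a))%N -> twcoef (phi a) i != 0 ->
      w (twcoef (phi a) i)%:A = 0%E.
    move=> ir A0; apply/eqP/negPn/negP => h; apply: nS; right.
    by exists i => //=.
  have vz x : x != 0 -> w x%:A = 0%E -> fine (v x) = 0.
    move=> x0; rewrite he (valuation_fin hv x0) => -[] /eqP.
    by rewrite mulf_eq0 => /orP [/eqP h|/eqP //]; move: e0; rewrite -ltz_nat h.
  have c0 : c != 0.
    apply: contraNneq y_neq0 => c0; move/eqP: yc; rewrite c0 scale0r expf_eq0.
    by move=> /andP [].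
  have wc : w c%:A = 0%E.
    rewrite -yc.
    have [_ _ wM _ _] := hwv; elim: (p ^ m)%N => [|n IHn]; last first.
      by rewrite exprS wM wy IHn adde0.
    have := wM 1 1; rewrite mulr1 expr0 (valuation_fin hwv (oner_neq0 L)).
    rewrite -EFinD => -[] h; congr (_%:E); apply/esym.
    by apply: (addrI (fine (w 1))); rewrite addr0 {1}h.
  rewrite (local_heightE Uv hw) root_height_trivial ?mulr0 //.
    by right; rewrite /root_val /val_real (vz c c0 wc) mul0r.
  move=> i ir; have [A0|A0] := eqVneq (twcoef (phi a) i) 0.
    by left; rewrite A0 /frob expr0n expn_eq0 eqn0Ngt p_gt0.
  right; rewrite (root_val_exp _ p_gt0 _ hv A0) /val_real.
  by rewrite (vz _ A0 (wA i ir A0)).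
rewrite finite_setU; split; first exact: Lfin.
apply: bigcup_finite => // i _; have [A0|A0] := eqVneq (twcoef (phi a) i) 0.
  by apply: (sub_finite_set _ (@finite_set0 _)) => w [].
have A0' : (twcoef (phi a) i)%:A != 0 :> L by rewrite scaler_eq0 oner_eq0 orbF.
by apply: sub_finite_set (Lfin _ A0') => w [].
Qed.

(** By [sum_ext_deg] the local heights above [v] add up to [d v * root_height v]; the local heights
    at all other places are nonnegative. *)
Lemma height_ge (T : set (K -> \bar int)) : finite_set T -> T `<=` U ->
  \sum_(v \in T) d v * root_height v <= height q phi U d a y.
Proof.
move=> Tfin TU; pose ext v := [set w : L -> \bar int | extends w v].
pose ST := \bigcup_(v in T) ext v.
have STfin : finite_set ST.
  by apply: bigcup_finite => // v Tv; apply: finite_extends; apply: TU.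
have STU : ST `<=` @ext_set K L U by move=> w [v Tv hw]; exists v => //; apply: TU.
pose LH w := local_height q phi d a w y.
have LH0 w : ext_set U w -> 0 <= LH w by apply: local_height_ge0.
apply: le_trans (_ : \sum_(w \in ST) LH w <= _).
  rewrite le_eqVlt; apply/orP; left; apply/eqP.
  (* The indicator of [extends w v] gives both sums fixed ranges, so that they can be exchanged;
     each [w] lies above a single [v]. *)
  transitivity (\sum_(v \in T) \sum_(w \in ST) if `[< extends w v >] then LH w else 0).
    apply: eq_fsbigr => v; rewrite inE => Tv.
    have Uv := TU _ Tv.
    rewrite -[in LHS](sum_ext_deg Uv) -/(ext v).
    have <- : \sum_(w \in ext v) (if `[< extends w v >] then LH w else 0)
        = \sum_(w \in ST) (if `[< extends w v >] then LH w else 0).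
      by apply: fsbig_widen => w; [exists v | move=> [_ /= nw]; case: asboolP].
    rewrite mulrC mulr_fsumr.
    apply: eq_fsbigr => w; rewrite inE => hw.
    by rewrite asboolT // /LH (local_heightE Uv hw) mulrC.
  rewrite exchange_fsbig //; apply: eq_fsbigr => w; rewrite inE => -[v Tv hw].
  rewrite (fsbigD1 v) //=.
  rewrite asboolT // fsbig1 ?addr0 // => v' [Tv' nv].
  case: asboolP => // hw'; exfalso; apply: nv.
  by apply: (extends_unique _ _ hw' hw); apply/U_val/TU.
pose S := [set w | ext_set U w /\ LH w != 0].
rewrite /height -(fsbig_widen (ST `|` S) (@ext_set K L U)); last 2 first.
- by move=> w [/STU|[]].
- move=> w [Uw nw] /=; apply/eqP/negPn/negP => h; apply: nw; right; split => //.
have SF : finite_set (ST `|` S).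
  by rewrite finite_setU; split => //; apply: finite_local_height.
rewrite (fsbigID ST) // [X in _ <= X + _](_ : _ = \sum_(w \in ST) LH w); last first.
  congr (\big[_/_]_(_ \in _) _); apply/seteqP; split; first by move=> w [].
  by move=> w hw; split => //; left.
rewrite lerDl; apply: fsumr_ge0 => w [hw _].
by apply: LH0; case: hw => [/STU|[]].
Qed.

End Extension.

(** * Degrees of a Drinfeld module *)

Section Dependence.
Variables (R : realType) (Fq F : fieldType) (iF : {rmorphism Fq -> F}).

(** Transcendence degree 1 excludes two independent elements; the relation in two variables is
    rewritten as a double sum by collecting monomials according to their exponents. *)
Lemma function_field_dependent (x y : F) : is_function_field R iF ->
  exists N (c : nat -> nat -> Fq),
    (exists k l, [/\ (k < N)%N, (l < N)%N & c k l != 0]) /\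
    \sum_(k < N) \sum_(l < N) iF (c k l) * x ^+ k * y ^+ l = 0.
Proof.
move=> [_ trd]; pose u (i : 'I_2) := if val i == 0%N then x else y.
have : ~ alg_independent (range iF) u.
  move=> ind; have : (2%:R%:E <= (1%:E : \bar R))%E.
    by rewrite -trd; apply: ereal_sup_ubound; exists 2%N => //; exists u.
  by rewrite lee_fin leNgt ltr1n.
move=> /existsNP [P /not_implyP [coefP /not_implyP [P0 Pn0]]].
have /choice [pre preE] : forall m, exists b, iF b = mpoly.mcoeff m P.
  by move=> m; have [b _ <-] := coefP m; exists b.
pose i0 : 'I_2 := ord0; pose i1 : 'I_2 := ord_max.
pose s := mpoly.msupp P.
pose N := (\max_(m <- s) (m i0 + m i1)).+1.
have Nlt m : m \in s -> (m i0 < N)%N /\ (m i1 < N)%N.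
  move=> ms; have : (m i0 + m i1 < N)%N.
    by rewrite ltnS; apply: (@leq_bigmax_seq _ s xpredT (fun m : mpoly.multinom 2 => m i0 + m i1)%N).
  by lia.
have i01 (i : 'I_2) : i = i0 \/ i = i1.
  by case: i => -[|[|//]] h; [left|right]; apply/val_inj.
exists N, (fun k l => \sum_(m <- s | (m i0 == k) && (m i1 == l)) pre m); split.
  have : s != [::] by rewrite /s mpoly.msupp_eq0; apply/eqP.
  case sE : s => [//|m s'] _.
  have ms : m \in s by rewrite sE mem_head.
  have [h0 h1] := Nlt m ms; exists (m i0), (m i1); split => //.
  rewrite -sE big_mkcond (bigD1_seq m) ?mpoly.msupp_uniq //= !eqxx /=.
  rewrite big1 ?addr0; first by rewrite -(fmorph_eq0 iF) preE -mpoly.mcoeff_msupp.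
  move=> m' /eqP nm; case: ifP => // /andP [/eqP e0 /eqP e1]; case: nm.
  by apply/mpoly.mnmP => i; case: (i01 i) => ->.
transitivity (\sum_(m <- s) \sum_(k < N) \sum_(l < N)
   (if (m i0 == k :> nat) && (m i1 == l :> nat) then iF (pre m) * x ^+ k * y ^+ l else 0)).
  rewrite [RHS]exchange_big; apply: eq_bigr => k _.
  rewrite [RHS]exchange_big; apply: eq_bigr => l _.
  by rewrite rmorph_sum !mulr_suml big_mkcond.
rewrite -[RHS]P0 mpoly.mevalE; apply: eq_big_seq => m ms.
have [h0 h1] := Nlt m ms.
rewrite (bigD1 (Ordinal h0)) //= [X in _ + X]big1 ?addr0; last first.
  move=> k nk; rewrite big1 // => l _; case: ifP => // /andP [/eqP e _].
  by case/eqP: nk; apply/val_inj.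
rewrite (bigD1 (Ordinal h1)) //= !eqxx /= big1 ?addr0; last first.
  move=> l nl; case: ifP => // /eqP e.
  by case/eqP: nl; apply/val_inj.
rewrite preE -mulrA; congr (_ * _).
rewrite big_ord_recl big_ord1 /u /=.
by have -> : lift ord0 ord0 = i1 by apply/val_inj.
Qed.

Lemma horner_map_poly_def n (c : nat -> Fq) (x : F) :
  (map_poly iF (\poly_(l < n) c l)).[x] = \sum_(l < n) iF (c l) * x ^+ l.
Proof.
rewrite (@horner_coef_wide _ n) ?size_map_poly ?size_poly //.
by apply: eq_bigr => l _; rewrite coef_map coef_poly ltn_ord.
Qed.

End Dependence.

Section Drinfeld.
Variables (R : realType) (p f : nat) (Fq : finFieldType) (F : fieldType).
Variables (iF : {rmorphism Fq -> F}) (oo : F -> \bar int).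
Variables (A : comNzRingType) (iA : {rmorphism A -> F}).
Hypothesis A_ring : is_function_ring R iF oo iA.
Variables (K : fieldType) (tau : {rmorphism K -> K}).
Hypotheses (charK : p \in [pchar K]) (f_gt0 : (0 < f)%N).
Let q := (p ^ f)%N.
Hypothesis tauE : forall x, tau x = x ^+ q.
Variables (phi : {rmorphism A -> twpoly tau}) (t : A).
Hypothesis t_gt0 : (0 < twdeg (phi t))%N.

Let iA_inj : injective iA.
Proof. by case: A_ring. Qed.

Lemma exists_constant (c : Fq) : exists a, iA a = iF c.
Proof.
have [-> |c0] := eqVneq c 0; first by exists 0; rewrite !rmorph0.
have [_ _ _ rA] := A_ring; suff : range iA (iF c) by case=> a _; exists a.
by rewrite rA => v [_ hv] _; rewrite hv.
Qed.

Let constant c : A := xget 0 [set a | iA a = iF c].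

Let constantE c : iA (constant c) = iF c.
Proof. by have := xgetPex 0 (exists_constant c). Qed.

Let constant0 : constant 0 = 0.
Proof. by apply: iA_inj; rewrite constantE !rmorph0. Qed.

Lemma twdeg_add0 (P Q : twpoly tau) :
  twdeg P = 0%N -> twdeg Q = 0%N -> twdeg (P + Q) = 0%N.
Proof.
move=> hP hQ; apply/eqP; rewrite -leqn0; apply: twdeg_le => i i0.
rewrite /twcoef coefD -/(twcoef P i) -/(twcoef Q i) !twcoef_gt ?hP ?hQ //.
exact: addr0.
Qed.

Lemma twdeg_mul0 (P Q : twpoly tau) :
  twdeg P = 0%N -> twdeg Q = 0%N -> twdeg (P * Q) = 0%N.
Proof.
move=> hP hQ; have [->|P0] := eqVneq P 0; first by rewrite mul0r /twdeg size_poly0.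
have [->|Q0] := eqVneq Q 0; first by rewrite mulr0 /twdeg size_poly0.
by have [_ ->] := twmul_neq0 charK tauE P0 Q0; rewrite hP hQ.
Qed.

Lemma twdeg1 : twdeg (1 : twpoly tau) = 0%N.
Proof.
by rewrite /twdeg (_ : (1 : twpoly tau) = 1%:P) // size_polyC oner_neq0.
Qed.

Lemma twdeg0 : twdeg (0 : twpoly tau) = 0%N.
Proof. by rewrite /twdeg size_poly0. Qed.

Lemma twdeg_nat n : twdeg (n%:R : twpoly tau) = 0%N.
Proof.
by elim: n => [|n IHn]; rewrite ?twdeg0 // -natr1 twdeg_add0 ?twdeg1.
Qed.

Lemma twdeg_sum0 n (P : nat -> twpoly tau) :
  (forall i, (i < n)%N -> twdeg (P i) = 0%N) -> twdeg (\sum_(i < n) P i) = 0%N.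
Proof.
elim: n => [|n IHn] h; first by rewrite big_ord0 twdeg0.
by rewrite big_ord_recr /= twdeg_add0 ?h ?IHn // => i ni; apply/h/leqW.
Qed.

(** From [c ^ #|Fq| = c] the degree equals [#|Fq|] times itself, hence is 0; the inverse constant
    gives nonvanishing. *)
Lemma phi_constant c : twdeg (phi (constant c)) = 0%N /\
  (c != 0 -> phi (constant c) != 0).
Proof.
have [->|c0] := eqVneq c 0; first by rewrite constant0 rmorph0 twdeg0.
have n0 : phi (constant c) != 0.
  apply/eqP => h; have : phi (constant c * constant c^-1) != 0.
    have -> : constant c * constant c^-1 = 1.
      by apply: iA_inj; rewrite rmorphM !constantE -rmorphM divff // !rmorph1.
    by rewrite rmorph1 oner_neq0.
  by rewrite rmorphM h mul0r eqxx.
split => //; have [_ e] := twexp_neq0 charK tauE #|Fq| n0.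
move: e; rewrite -rmorphXn /=.
have -> : constant c ^+ #|Fq| = constant c.
  by apply: iA_inj; rewrite rmorphXn !constantE -rmorphXn expf_card.
move=> e; have gt1 : (1 < #|Fq|)%N by exact: finNzRing_gt1.
 apply/eqP; rewrite -leqn0 leqNgt; apply/negP => d0.
by move/eqP: e; rewrite -[eqbLHS]mul1n eqn_pmul2r // ltn_eqF.
Qed.

Let phi_poly_neq0 n (c : nat -> Fq) : (exists2 i, (i < n)%N & c i != 0) ->
  phi (\sum_(i < n) constant (c i) * t ^+ i) != 0.
Proof.
move=> [i ni ci]; rewrite rmorph_sum /=.
under eq_bigr do rewrite rmorphM rmorphXn.
apply: (twsum_neq0 charK tauE t_gt0 (c := fun i => phi (constant (c i)))).
  by move=> k _; case: (phi_constant (c k)).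
by exists i => //; case: (phi_constant (c i)) => _; apply.
Qed.

Lemma relation_in_A (x y : A) N (c : nat -> nat -> Fq) :
  \sum_(k < N) \sum_(l < N) iF (c k l) * iA x ^+ k * iA y ^+ l = 0 ->
  \sum_(k < N) (\sum_(l < N) constant (c k l) * y ^+ l) * x ^+ k = 0.
Proof.
move=> h; apply: iA_inj; rewrite rmorph0 -[RHS]h rmorph_sum.
apply: eq_bigr => k _; rewrite rmorphM rmorphXn rmorph_sum mulr_suml.
apply: eq_bigr => l _; rewrite rmorphM rmorphXn constantE; exact: mulrAC.
Qed.

(* In a relation between [x] in the kernel and [t], divide by the largest power
   of [x] and apply [phi]: a nonzero polynomial in [t] would be in the kernel. *)
Lemma phi_neq0 x : x != 0 -> phi x != 0.
Proof.
move=> x0; apply/eqP => phix.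
have [ff _ _ _] := A_ring.
have [N [c [[k [l [kN lN ckl]]] /relation_in_A rel]]] :=
  function_field_dependent (iA x) (iA t) ff.
have exk : exists k, (k < N)%N && [exists l : 'I_N, c k l != 0].
  by exists k; rewrite kN; apply/existsP; exists (Ordinal lN).
case: (ex_minnP exk) => k0 /andP [k0N /existsP [l0 ck0]] kmin.
pose a k := \sum_(l < N) constant (c k l) * t ^+ l.
have ak k' : (k' < k0)%N -> a k' = 0.
  move=> k'0; rewrite /a big1 // => l' _.
  have [->|nz] := eqVneq (c k' l') 0; first by rewrite constant0 mul0r.
  have : (k0 <= k')%N.
    by apply: kmin; rewrite (ltn_trans k'0 k0N); apply/existsP; exists l'.
  by rewrite leqNgt k'0.
have shift : \sum_(k < N) a k * x ^+ k
    = x ^+ k0 * \sum_(j < N - k0) a (k0 + j)%N * x ^+ j.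
  rewrite (bigID (fun k : 'I_N => (k0 <= k)%N)) /= [X in _ + X]big1 ?addr0; last first.
    by move=> k'; rewrite -ltnNge => /ak ->; rewrite mul0r.
  rewrite mulr_sumr.
  have := @sum_ord_shift _ N k0 (N - k0)%N
    (fun k => if (k < N)%N then a k * x ^+ k else 0).
  rewrite subnKC ?(ltnW k0N) // => /(_ (leqnn _)) => H.
  transitivity (\sum_(k < N | (k0 <= k)%N) if (k < N)%N then a k * x ^+ k else 0).
    by apply: eq_bigr => k' _; rewrite ltn_ord.
  rewrite H; last by move=> k' kk'; rewrite ltnNge kk'.
  apply: eq_bigr => j _; rewrite -ltn_subRL ltn_ord exprD.
  by rewrite mulrCA.
have : \sum_(j < N - k0) a (k0 + j)%N * x ^+ j = 0.
  apply: iA_inj; rewrite rmorph0; apply/eqP.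
  have := congr1 iA shift; rewrite rel rmorph0 rmorphM rmorphXn => /esym/eqP.
  rewrite mulf_eq0 expf_eq0 => /orP [/andP [_ /eqP ix]|//].
  by case/eqP: x0; apply: iA_inj; rewrite ix rmorph0.
have -> : (N - k0 = (N - k0).-1.+1)%N by rewrite prednK // subn_gt0.
rewrite big_ord_recl => /(congr1 phi).
rewrite rmorphD rmorph_sum /= big1 ?addr0; last first.
  by move=> j _; rewrite rmorphM rmorphXn /= phix expr0n mulr0.
rewrite rmorph0 addn0 expr0 mulr1 => /eqP; apply/negP.
by apply: phi_poly_neq0; exists l0.
Qed.

(** If [phi a] had degree 0, so would the image of every polynomial in [a] over [Fq]. A relation
    between [t] and [a], ordered by powers of [t], then contradicts [twsum_neq0]: some coefficient
    is nonzero because [a] is transcendental and [phi] is injective. *)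
Lemma phi_deg_gt0 a : nonconstant iF iA a -> (0 < twdeg (phi a))%N.
Proof.
move=> na; rewrite lt0n; apply/eqP => da.
have [ff _ _ _] := A_ring.
have [N [c [[k [l [kN lN ckl]]] /relation_in_A rel]]] :=
  function_field_dependent (iA t) (iA a) ff.
have := congr1 phi rel; rewrite rmorph0 rmorph_sum /=.
under eq_bigr do rewrite rmorphM rmorphXn.
apply/eqP; apply: (twsum_neq0 charK tauE t_gt0
  (c := fun k => phi (\sum_(l < N) constant (c k l) * a ^+ l))).
  move=> k' _; rewrite rmorph_sum /=.
  apply: (@twdeg_sum0 N (fun l => phi (constant (c k' l) * a ^+ l))) => l' _.
  rewrite rmorphM rmorphXn /=; apply: twdeg_mul0; first by case: (phi_constant (c k' l')).
  elim: l' => [|l' IHl]; first by rewrite expr0 twdeg1.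
  by rewrite exprS twdeg_mul0.
exists k => //; apply: phi_neq0; apply/eqP => /(congr1 iA) bk; apply: na.
exists (\poly_(l < N) c k l).
  by apply/eqP => /polyP /(_ l); rewrite coef_poly lN coef0 => /eqP; apply/negP.
rewrite rootE horner_map_poly_def -[X in _ == X](rmorph0 iA) -bk rmorph_sum.
by apply/eqP/eq_bigr => i _; rewrite rmorphM rmorphXn constantE.
Qed.

(** A linear relation between iterates says that [phi] at a polynomial in [t] with top coefficient 1
    kills [x]; that element of [A] is nonzero by [twsum_neq0]. *)
Lemma pfree_orbit (m : nat) (x : K) :
  (forall b, b != 0 -> tweval q (fun z => z ^+ (p ^ m)) (phi b) x != 0) ->
  forall n, pfree (orbit_seq p f (twdeg (phi t))
    (fun i => twcoef (phi t) i ^+ (p ^ m)) n x).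
Proof.
move=> nt; set frob := fun z : K => z ^+ (p ^ m) in nt *.
have frobD : {morph frob : x y / x + y} by move=> y z; apply: exprDp.
have frobM : {morph frob : x y / x * y} by move=> y z; apply: exprMn.
have frob1 : frob 1 = 1 by exact: expr1n.
pose Phi := addpoly p f (twdeg (phi t)) (fun i => frob (twcoef (phi t) i)).
elim=> //= n IHn; split => // /(@pspan_min _ (fun z =>
  exists c : nat -> nat, z = \sum_(i < n) (c i)%:R * iter i Phi x)).
case.
- by exists (fun=> 0%N); rewrite big1 // => i _; rewrite mul0r.
- move=> _ _ [c ->] [c' ->]; exists (fun i => c i + c' i)%N.
  by rewrite -big_split; apply: eq_bigr => i _; rewrite natrD mulrDl.
- move=> z /orbit_seqP [k kn ->]; exists (fun i => (i == k) : nat).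
  rewrite (bigD1 (Ordinal kn)) //= eqxx mul1r big1 ?addr0 // => i.
  by rewrite -val_eqE /= => /negbTE ->; rewrite mul0r.
move=> c hc; have [b b1] := opp_natr charK.
pose e i := if (i < n)%N then (b * c i)%N else 1%N.
have e0 : \sum_(i < n.+1) (e i)%:R * iter i Phi x = 0.
  rewrite big_ord_recr /= {2}/e ltnn mul1r hc -big_split big1 //= => i _.
  by rewrite /e ltn_ord natrM b1 -mulrA mulN1r addNr.
have P0 : \sum_(i < n.+1) (e i)%:R * phi t ^+ i != 0 :> twpoly tau.
  apply: (twsum_neq0 charK tauE t_gt0 (c := fun i => (e i)%:R)).
    by move=> i _; exact: twdeg_nat.
  by exists n => //; rewrite /e ltnn oner_neq0.
pose a : A := \sum_(i < n.+1) (e i)%:R * t ^+ i.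
have aE : phi a = \sum_(i < n.+1) (e i)%:R * phi t ^+ i.
  by rewrite rmorph_sum; apply: eq_bigr => i _; rewrite rmorphM rmorphXn rmorph_nat.
have a0 : a != 0 by apply: contraNneq P0 => a0; rewrite -aE a0 rmorph0.
have /eqP := nt a a0; apply; rewrite aE -[RHS]e0.
have twsum k (P : nat -> twpoly tau) : tweval q frob (\sum_(i < k) P i) x
    = \sum_(i < k) tweval q frob (P i) x.
  elim: k => [|k IHk]; first by rewrite !big_ord0; apply: tweval0.
  by rewrite !big_ord_recr /= -IHk; apply: twevalD.
rewrite (twsum _ (fun i => (e i)%:R * phi t ^+ i)).
apply: eq_bigr => i _; rewrite mulr_natl.
have -> : tweval q frob (phi t ^+ i *+ e i) x
    = (e i)%:R * tweval q frob (phi t ^+ i) x by apply: tweval_natmul.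
by rewrite (twevalX charK tauE frobD frobM frob1).
Qed.

End Drinfeld.

(** * Field of definition over the constants *)

Section SubfieldType.
Variables (E : fieldType) (S : set E).

(** Indexing the predicate by the closure proof lets instances be attached to it; the set becomes a
    field type over which algebraicity can be stated. *)
Definition subfield_pred (_ : is_subfield S) : {pred E} := [pred x | x \in S].

Variable hS : is_subfield S.

Lemma subfield_divring_closed : divring_closed (subfield_pred hS).
Proof.
have [S1 SB SD] := hS; split; rewrite ?inE //.
- by move=> x y; rewrite !inE; apply: SB.
- by move=> x y; rewrite !inE; apply: SD.
Qed.

HB.instance Definition _ :=
  GRing.isDivringClosed.Build E (subfield_pred hS) subfield_divring_closed.

Record subfield_of := SubfieldOf {
  subfield_val : E; subfield_valP : subfield_val \in subfield_pred hS }.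

HB.instance Definition _ := [isSub for subfield_val].
HB.instance Definition _ := [Choice of subfield_of by <:].
HB.instance Definition _ := [SubChoice_isSubIntegralDomain of subfield_of by <:].
HB.instance Definition _ := [SubIntegralDomain_isSubField of subfield_of by <:].

Definition subfield_incl : {rmorphism subfield_of -> E} := \val.

Lemma subfield_inclP x : S x <-> exists y, subfield_incl y = x.
Proof.
split; last by case=> y <-; have := subfield_valP y; rewrite inE.
move=> Sx; have Sx' : x \in subfield_pred hS by rewrite inE.
by exists (SubfieldOf Sx').
Qed.

End SubfieldType.

Lemma gen_field_min (E : fieldType) (S P : set E) :
  is_subfield P -> S `<=` P -> gen_field S `<=` P.
Proof. exact: smallest_sub. Qed.

Section AlgebraicCoefficients.
Variables (k E : fieldType) (h : {rmorphism k -> E}).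

Lemma algebraic_sum (I : Type) (r : seq I) (P : pred I) (F : I -> E) :
  (forall i, P i -> algebraicOver h (F i)) ->
  algebraicOver h (\sum_(i <- r | P i) F i).
Proof.
move=> hF; elim/big_ind: _ => //; first exact: algebraic0.
by move=> x y; apply: algebraic_add.
Qed.

Lemma algebraic_exp n x : algebraicOver h x -> algebraicOver h (x ^+ n).
Proof.
move=> hx; elim: n => [|n IHn]; first exact: algebraic1.
by rewrite exprS; apply: algebraic_mul.
Qed.

Lemma algebraic_of_exp n x : (0 < n)%N -> (exists c, x ^+ n = h c) ->
  algebraicOver h x.
Proof.
move=> n0 [c hc]; exists ('X^n - c%:P).
  by rewrite -size_poly_eq0 size_XnsubC.
by rewrite rmorphB /= map_polyXn map_polyC rootE !hornerE hc subrr.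
Qed.

(** [x] is a root of the monic polynomial [X^n - (X + c)], whose coefficients are algebraic. *)
Lemma algebraic_Artin_Schreier n x c : (1 < n)%N -> x ^+ n - x = c ->
  algebraicOver h c -> algebraicOver h x.
Proof.
move=> n1 xc hc; apply/integral_algebraic.
have sq : (size ('X + c%:P : {poly E})%R < size ('X^n : {poly E})%R)%N.
  by rewrite size_polyXn size_XaddC.
apply: (@integral_root_monic _ _ _ x ('X^n - ('X + c%:P))).
- by rewrite monicE lead_coefDl ?size_polyN // lead_coefXn.
- by rewrite rootE !hornerE -xc; apply/eqP; ring.
move=> z /(nthP 0) [i _ <-]; rewrite coefB coefD coefXn coefX coefC.
have hn (b : bool) : integralOver h b%:R by exact: integral_nat.
apply: integral_sub => //; apply: integral_add => //.
by apply/integral_algebraic; case: ifP => _ //; exact: algebraic0.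
Qed.

(* Comparing the coefficients of [tau^(i+r)] in [b a = a b] expresses
   [(b i)^(q^r) - b i] through the [a]'s and the [b l] with [l > i]. *)
Lemma algebraic_commutant q r s (a b : nat -> E) : (1 < q)%N -> (0 < r)%N ->
  a r = 1 -> (forall i, (r < i)%N -> a i = 0) ->
  (forall i, algebraicOver h (a i)) -> (forall i, (s < i)%N -> b i = 0) ->
  (forall n, \sum_(i < n.+1) a i * b (n - i)%N ^+ (q ^ i)
           = \sum_(i < n.+1) b i * a (n - i)%N ^+ (q ^ i)) ->
  forall i, algebraicOver h (b i).
Proof.
move=> q1 r0 ar1 ar0 ha bs0 comm.
have exp0 i : (0 : E) ^+ (q ^ i) = 0.
  by rewrite expr0n expn_eq0 eqn0Ngt (ltn_trans _ q1).
(* Descending induction on the index, [m] measuring how far below the top it may lie. *)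
suff H m : forall i, (s < i + m)%N -> algebraicOver h (b i).
  by move=> i; apply: (H s.+1); rewrite addnS ltnS leq_addl.
elim: m => [|m IHm] i si.
  by rewrite bs0; [exact: algebraic0 | rewrite -[i]addn0].
have IH l : (i < l)%N -> algebraicOver h (b l).
  by move=> il; apply: IHm; apply: leq_trans si _; rewrite addnS -addSn leq_add2r.
have lt_r : (r < (i + r).+1)%N by rewrite ltnS leq_addl.
have lt_i : (i < (i + r).+1)%N by rewrite ltnS leq_addr.
have := comm (i + r)%N.
rewrite (bigD1 (Ordinal lt_r)) // [in RHS](bigD1 (Ordinal lt_i)) //=.
rewrite ar1 mul1r addnK addKn ar1 expr1n mulr1.
set S1 := \sum_(_ | _) _; set S2 := \sum_(_ | _) _ => e.
apply: (@algebraic_Artin_Schreier (q ^ r) _ (S2 - S1)).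
- by rewrite -(expn0 q) ltn_exp2l.
- have -> : S2 = b i ^+ (q ^ r) + S1 - b i.
    by apply/eqP; rewrite eq_sym subr_eq e addrC.
  by ring.
apply: algebraic_sub; apply: algebraic_sum => l; rewrite -val_eqE /= neq_ltn.
  case/orP=> il; last by apply: algebraic_mul; [apply: IH | apply: algebraic_exp].
  rewrite [a (_ - _)%N]ar0 ?exp0 ?mulr0; first exact: algebraic0.
  by rewrite ltn_subRL ltn_add2r.
case/orP=> il; last by rewrite ar0 // mul0r; apply: algebraic0.
apply: algebraic_mul => //; apply: algebraic_exp; apply: IH.
by rewrite ltn_subRL addnC ltn_add2l.
Qed.

Lemma algebraic_is_subfield : is_subfield (fun x : E => algebraicOver h x).
Proof.
split; first exact: algebraic1.
  by move=> x y; apply: algebraic_sub.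
by move=> x y; apply: algebraic_div.
Qed.

(** A nonempty family would contain an algebraic element; its equation, read as a polynomial [Q] in
    the variable of index [ord0], contradicts independence. *)
Lemma algebraic_trdeg (R : realType) (S : set E) :
  (forall x, S x -> algebraicOver h x) -> (trdeg R (range h) S <= 0)%E.
Proof.
move=> Salg; apply: ge_ereal_sup => _ [[|n] [x [Sx ind]] <-]; first by rewrite lee_fin.
exfalso; have [P P0 Pr] := Salg _ (Sx ord0).
pose X : mpoly.mpoly n.+1 E := mpoly.mpolyX E (mpoly.mnm1 ord0).
pose Q := \sum_(l < size P) h P`_l *: X ^+ l.
have QE m : mpoly.mcoeff m Q
    = \sum_(l < size P) h P`_l * (mpoly.mnm_muln (mpoly.mnm1 ord0) l == m)%:R.
  rewrite raddf_sum; apply: eq_bigr => l _.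
  by rewrite /= mpoly.mcoeffZ /X mpoly.mcoeffXn.
have : Q = 0.
  apply: ind => [m|].
    rewrite QE; exists (\sum_(l < size P)
      P`_l * (mpoly.mnm_muln (mpoly.mnm1 ord0) l == m)%:R) => //.
    by rewrite rmorph_sum; apply: eq_bigr => l _; rewrite rmorphM rmorph_nat.
  move/rootP: Pr; rewrite (@horner_coef_wide _ (size P)) ?size_map_poly // => Pr.
  rewrite -[RHS]Pr /Q raddf_sum; apply: eq_bigr => l _.
  by rewrite /= mpoly.mevalZ rmorphXn /= /X mpoly.mevalXU coef_map.
have sP : ((size P).-1 < size P)%N by rewrite prednK ?size_poly_gt0.
move=> /(congr1 (mpoly.mcoeff (mpoly.mnm_muln (mpoly.mnm1 ord0) (size P).-1))).
rewrite QE raddf0 (bigD1 (Ordinal sP)) //= eqxx mulr1 big1 ?addr0.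
  by move/eqP; rewrite fmorph_eq0 -/(lead_coef P) lead_coef_eq0 (negbTE P0).
move=> l nl; case: eqP => [/mpoly.mnmP /(_ ord0)|]; last by rewrite mulr0.
rewrite !mpoly.mulmnE !mpoly.mnm1E eqxx !mul1n => e.
by case/eqP: nl; apply/val_inj.
Qed.

End AlgebraicCoefficients.

(** * The field of constants *)

Section Constants.
Variables (R : realType) (K : fieldType) (U : set (K -> \bar int)).
Variable d : (K -> \bar int) -> R.
Hypothesis U_good : good_set U d.

Let U_val v : U v -> is_valuation v.
Proof. by case: U_good => h _ _ _; apply: h. Qed.

(** All terms of the product formula are nonnegative, so each vanishes. [root_val R 1 0 v] is [v]
    with real values. *)
Lemma constants_ge0 x : (forall v, U v -> vge (root_val R 1 0 v) 0 x) ->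
  constants U x.
Proof.
move=> hx; have [->|x0] := eqVneq x 0; [by left | right => v Uv].
pose T := [set v | U v /\ v x != 0%E].
have TU : T `<=` U by move=> w [].
have Tfin : finite_set T by case: U_good => _ _ h _; apply: h.
have hx' w : U w -> 0 <= val_real R (w x).
  by move=> Uw; have := vge_neq0 x0 (hx w Uw); rewrite root_val0E.
have sum0 : \sum_(w \in T) d w * val_real R (w x) = 0.
  apply: (product_formula U_good TU x0) => w Uw nT; apply/eqP.
  rewrite (valuation_fine_neq0 _ (U_val Uw) x0); apply/negPn/negP => nw.
  by apply: nT.
have d_ge w : U w -> 0 < d w by case: U_good => _ h _ _; apply: h.
apply/eqP/negPn/negP => nv.
have /eqP : d v * val_real R (v x) = 0.
  apply: (pfsumr_eq0 (F := fun w => d w * val_real R (w x)) Tfin _ sum0) => //.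
  by move=> w [Uw _]; rewrite mulr_ge0 ?hx' // ltW ?d_ge.
rewrite mulf_eq0 gt_eqF ?d_ge //= (valuation_fine_neq0 _ (U_val Uv) x0).
by rewrite (negbTE nv).
Qed.

Lemma constants_is_subfield : is_subfield (constants U).
Proof.
have NP v : U v -> real_valuation (root_val R 1 0 v).
  by move=> Uv; apply: root_val_real_valuation => //; apply: U_val.
have cge x v : constants U x -> U v -> vge (root_val R 1 0 v) 0 x.
  by move=> [->|h] Uv; [left | right; rewrite root_val0E h].
split.
- apply: constants_ge0 => v Uv; right; rewrite (rval1 (NP v Uv)) //.
- move=> x y cx cy; apply: constants_ge0 => v Uv.
  by apply: (vgeB (NP v Uv)); apply: cge.
- move=> x y cx cy; apply: constants_ge0 => v Uv.
  have [y0|y0] := eqVneq y 0; first by left; rewrite y0 invr0 mulr0.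
  rewrite -[X in vge _ X _]addr0; apply: (vgeM (NP v Uv)); first exact: cge.
  right; rewrite (rvalV (NP v Uv)) // root_val0E.
  by case: cy => [y00|->//]; [rewrite y00 eqxx in y0 | rewrite /val_real oppr0].
Qed.

End Constants.

(** * Existence of a place with a negative slope *)

Section BadPlace.
Variables (R : realType) (p f : nat) (K : fieldType).
Hypotheses (charK : p \in [pchar K]) (f_gt0 : (0 < f)%N).
Variables (U : set (K -> \bar int)) (d : (K -> \bar int) -> R).
Hypothesis U_good : good_set U d.
Variables (E : closedFieldType) (j : {rmorphism K -> E}).
Variables (tau : {rmorphism K -> K}).
Let q := (p ^ f)%N.
Hypothesis tauE : forall x, tau x = x ^+ q.
Variables (Ar : comNzRingType) (phi : {rmorphism Ar -> twpoly tau}) (t : Ar).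
Let r := twdeg (phi t).
Hypothesis r_gt0 : (0 < r)%N.
Let A i := twcoef (phi t) i.

Let U_val v : U v -> is_valuation v.
Proof. by case: U_good => h _ _ _; apply: h. Qed.

Let q_gt1 : (1 < q)%N.
Proof. by rewrite -(expn0 p) ltn_exp2l // prime_gt1 // (pcharf_prime charK). Qed.

Let Q_gt1 : (1 < q ^ r)%N.
Proof. by rewrite -(expn0 q) ltn_exp2l. Qed.

Let Ar_neq0 : A r != 0.
Proof.
by apply: twpoly_neq0P; apply/eqP => h; move: r_gt0; rewrite /r h /twdeg size_poly0.
Qed.

Let subf := constants_is_subfield U_good.
Let k := subfield_of subf.

Definition constants_incl : {rmorphism k -> E} := j \o subfield_incl subf.

Lemma constants_inclP x : constants U x -> exists c, constants_incl c = j x.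
Proof. by move=> /(subfield_inclP subf) [y <-]; exists y. Qed.

(** The valuation of this ratio is [q^r - 1] times the slope at [i], hence nonnegative at every
    place. *)
Lemma slope_ratio_constant i : (i <= r)%N -> A i != 0 ->
  (forall v, U v -> 0 <= place_slope R p f r A v i) ->
  constants U (A i ^+ (q ^ r).-1 / A r ^+ (q ^ i).-1).
Proof.
move=> ir Ai hs; apply: (constants_ge0 U_good) => v Uv; right.
have NP := root_val_real_valuation R (isT : (0 < 1)%N) 0 (U_val Uv).
rewrite (rvalf NP) ?expf_neq0 // !(rvalX NP) // !root_val0E.
have := hs v Uv; rewrite /place_slope /reduced_val (negbTE Ai) /escape_shift !root_val0E.
set a := val_real R (v (A i)); set b := val_real R (v (A r)).
have qE n : (0 < n)%N -> (n.-1)%:R = n%:R - 1 :> R.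
  by move=> n0; rewrite -subn1 natrB.
have q_gt0 n : (0 < q ^ n)%N by rewrite expn_gt0 (ltn_trans _ q_gt1).
rewrite !qE //; set Qi := (q ^ i)%:R; set Q : R := (q ^ r)%:R.
have Q1 : 0 < Q - 1 by rewrite subr_gt0 ltr1n.
have -> : a + (Qi - 1) * (- b / (Q - 1)) = ((Q - 1) * a - (Qi - 1) * b) / (Q - 1).
  by field; rewrite lt0r_neq0.
by rewrite pmulr_lge0 // invr_gt0.
Qed.

(* Otherwise the product formula makes the ratios of [slope_ratio_constant]
   constant; after conjugation by [g] the coefficients of [phi t], and by
   [algebraic_commutant] those of every [phi b], are algebraic over the
   constants. *)
Lemma exists_bad_place :
  (0 < rel_modular_trdeg R q phi j (constants U))%E ->
  exists v i, [/\ U v, (i < r)%N, A i != 0 & place_slope R p f r A v i < 0].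
Proof.
move=> trd; apply: contrapT => nex.
have hs v i : U v -> (i <= r)%N -> A i != 0 -> 0 <= place_slope R p f r A v i.
  move=> Uv; rewrite leq_eqVlt => /predU1P [->|ir] Ai; last first.
    by rewrite leNgt; apply/negP => lt0; apply: nex; exists v, i.
  have h : ((q ^ r)%:R - 1) * escape_shift (root_val R p 0 v) p f r A
      = - root_val R p 0 v (A r).
    by apply: escape_shiftE.
  by rewrite /place_slope /reduced_val (negbTE Ai) h subrr.
(* Conjugation by this [g] makes the coefficient of [tau^r] in [phi t] equal to 1. *)
have [g gQ] : exists g : E, g ^+ (q ^ r).-1 = (j (A r))^-1.
  have : size ('X^((q ^ r).-1) - (j (A r))^-1%:P : {poly E}) != 1%N.
    by rewrite size_XnsubC -?subn1 ?subn_gt0 // eqSS -lt0n subn_gt0.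
  by move=> /closed_rootP [g /rootP]; rewrite !hornerE => /eqP; rewrite subr_eq0 => /eqP;
    exists g.
have jAr : j (A r) != 0 by rewrite fmorph_eq0.
have g0 : g != 0.
  apply/eqP => g0; move/eqP: gQ; rewrite g0 expr0n eq_sym.
  by rewrite -subn1 subn_eq0 leqNgt Q_gt1 /= invr_eq0 (negbTE jAr).
have q_gt0 n : (0 < q ^ n)%N by rewrite expn_gt0 (ltn_trans _ q_gt1).
pose cc b n := g^-1 * j (twcoef (phi b) n) * g ^+ (q ^ n).
have gX n : g ^+ (q ^ n) = g * g ^+ (q ^ n).-1 by rewrite -exprS prednK.
have ccE b i : cc b i = j (twcoef (phi b) i) * g ^+ (q ^ i).-1.
  rewrite /cc gX; move: (g ^+ _) (j _) => u w; by field.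
(* For nonzero [A i], the power of [cc t i] with exponent [q^r - 1] is the image of the constant
   ratio. *)
have algA i : algebraicOver constants_incl (cc t i).
  rewrite ccE.
  have [ir|ri] := leqP i r; last first.
    by rewrite twcoef_gt // rmorph0 mul0r; apply: algebraic0.
  have [A0|A0] := eqVneq (A i) 0.
    by rewrite -/(A i) A0 rmorph0 mul0r; apply: algebraic0.
  apply: (@algebraic_of_exp _ _ _ (q ^ r).-1); first by rewrite -subn1 subn_gt0.
  have [c hc] := constants_inclP (slope_ratio_constant ir A0 (fun v Uv => hs v i Uv ir A0)).
  exists c; rewrite hc exprMn exprAC gQ -/(A i) fmorph_div !rmorphXn /= -exprVn //.
have algB b i : algebraicOver constants_incl (cc b i).
  apply: (@algebraic_commutant _ _ constants_incl q r (twdeg (phi b)) (cc t) (cc b)) => //.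
  - by rewrite ccE gQ divff.
  - by move=> l rl; rewrite /cc twcoef_gt // rmorph0 mulr0 mul0r.
  - by move=> l rl; rewrite /cc twcoef_gt // rmorph0 mulr0 mul0r.
  move=> n; have conj a b' l : (l <= n)%N ->
      cc a l * cc b' (n - l)%N ^+ (q ^ l)
      = g^-1 * g ^+ (q ^ n) * j (twcoef (phi a) l * twcoef (phi b') (n - l) ^+ (q ^ l)).
    move=> ln; rewrite /cc !exprMn -exprM -expnD subnK // exprVn rmorphM rmorphXn /=.
    by field; rewrite expf_neq0 // g0.
  (* Commutativity of [A] makes [phi t] and [phi b] commute, and conjugation by [g] preserves
     this. *)
  have := congr1 (fun P => g^-1 * g ^+ (q ^ n) * j (twcoef P n))
    (etrans (esym (rmorphM phi t b)) (etrans (congr1 phi (mulrC t b)) (rmorphM phi b t))).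
  rewrite !(twcoefM tauE) !rmorph_sum !mulr_sumr => e.
  transitivity (\sum_(i < n.+1) g^-1 * g ^+ (q ^ n)
     * j (twcoef (phi t) i * twcoef (phi b) (n - i) ^+ (q ^ i))).
    by apply: eq_bigr => l _; rewrite conj // -ltnS.
  by rewrite e; apply: eq_bigr => l _; rewrite conj // -ltnS.
move: trd; rewrite ltNge => /negP; apply.
apply: le_trans (_ : trdeg R (j @` constants U) (gen_field (j @` constants U
    `|` field_of_definition q phi j g)) <= _)%E.
  by apply: ereal_inf_lbound; exists g.
have -> : j @` constants U = range constants_incl.
  apply/seteqP; split.
    by move=> _ [x /constants_inclP [c <-] <-]; exists c.
  move=> _ [c _ <-]; exists (subfield_incl subf c) => //.
  by apply/(subfield_inclP subf); exists c.
have alg_field := algebraic_is_subfield constants_incl.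
apply: algebraic_trdeg; apply: gen_field_min => // z [[c _ <-]|].
  exact: algebraic_id.
by apply: (gen_field_min alg_field) => _ [a [n ->]]; apply: algB.
Qed.

End BadPlace.

(** * The lower bound on the perfect closure *)

Lemma tweval_comp (K L E : fieldType) (tau : {rmorphism K -> K}) q
    (h : {rmorphism L -> E}) (i : K -> L) (j : K -> E) (P : twpoly tau) x :
  (forall c, h (i c) = j c) -> h (tweval q i P x) = tweval q j P (h x).
Proof.
move=> hij; rewrite rmorph_sum; apply: eq_bigr => l _.
by rewrite rmorphM rmorphXn /= hij.
Qed.

Theorem mainTheorem10
  (R : realType)
  (* the base field F_q and the ring A *)
  (p e q : nat) (p_prime : prime p) (q_def : q = (p ^ e.+1)%N)
  (Fq : finFieldType) (card_Fq : #|Fq| = q)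
  (F : fieldType) (iF : {rmorphism Fq -> F}) (oo : F -> \bar int)
  (A : comNzRingType) (iA : {rmorphism A -> F})
  (A_ring : is_function_ring R iF oo iA)
  (* the field K with its valuations, and an algebraic closure of K *)
  (K : fieldType) (charK : p \in [pchar K])
  (U : set (K -> \bar int)) (d : (K -> \bar int) -> R)
  (U_good : good_set U d) (U_coherent : coherent U d)
  (Kalg : closedFieldType) (j : {rmorphism K -> Kalg})
  (Kalg_closure : is_alg_closure j)
  (* the Drinfeld module *)
  (tau : {rmorphism K -> K}) (tauE : forall x, tau x = x ^+ q)
  (i : {rmorphism A -> K}) (phi : {rmorphism A -> twpoly tau})
  (phi_drinfeld : is_drinfeld i phi)
  (phi_trdeg : (0 < rel_modular_trdeg R q phi j (constants U))%E) :
  exists2 C : R, 0 < C &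
    forall x : Kalg, perfect_closure p j x -> ~ torsion q phi j x ->
    forall (a : A) (L : fieldExtType K) (g : {rmorphism L -> Kalg}) (y : L),
      nonconstant iF iA a -> (forall c : K, g c%:A = j c) -> g y = x ->
      C < height q phi U d a y.
Proof.
subst q; set q := (p ^ e.+1)%N in tauE phi_trdeg *.
(* [t] is chosen from [phi] alone, before [a] is given, so that the constant does not depend on
   [a]. *)
have [_ [t /eqP]] := phi_drinfeld; rewrite -lt0n => t_gt0.
have p_gt0 := prime_gt0 p_prime.
have lead0 : twcoef (phi t) (twdeg (phi t)) != 0.
  by apply: twpoly_neq0P; apply/eqP => h; move: t_gt0; rewrite h /twdeg size_poly0.
have [v0 [i0 [Uv0 i0r Ai0 slope0]]] :=
  exists_bad_place charK (ltn0Sn e) U_good tauE t_gt0 phi_trdeg.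
have [C C0 HC] := sum_local_heights charK (ltn0Sn e) t_gt0 U_good lead0
  Uv0 i0r Ai0 slope0.
exists C => // x [m [c _ jc]] ntors a L g y na gc gy.
pose frob (z : K) := z ^+ (p ^ m).
have frobD : {morph frob : y z / y + z} by move=> y' z; apply: exprDp.
have frobM : {morph frob : y z / y * z} by move=> y' z; apply: exprMn.
have frob1 : frob 1 = 1 by exact: expr1n.
have yc : y ^+ (p ^ m) = c%:A.
  by apply: (fmorph_inj g); rewrite rmorphXn /= gy gc jc.
have gev P : g (tweval q (in_alg L) (P : twpoly tau) y) = tweval q j P x.
  by rewrite -gy; apply: tweval_comp => z; rewrite in_algE gc.
have y0 : y != 0.
  apply/eqP => y0; apply: ntors; exists 1; first exact: oner_neq0.
  rewrite -gy y0 rmorph0; 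
  by apply: (tweval_at0 e.+1 charK); [exact: rmorphD | exact: rmorph1].
have frob_ntors b : b != 0 -> tweval q frob (phi b) c != 0.
  move=> b0; apply/eqP => ev0; apply: ntors; exists b => //; rewrite -gev.
  have := tweval_root e.+1 charK yc (phi b); rewrite -/frob ev0 scale0r => /eqP.
  by rewrite expf_eq0 => /andP [_ /eqP ->]; rewrite rmorph0.
have a_gt0 := phi_deg_gt0 A_ring charK tauE t_gt0 na.
have D_gt1 : (1 < q ^ twdeg (phi a))%N.
  by rewrite -expnM -(expn0 p) ltn_exp2l ?muln_gt0 // prime_gt1.
pose Phi := tweval q frob (phi a).
have bound v : U v -> exists B, forall z, `|minval (root_val R p m v) (Phi z)
    - (q ^ twdeg (phi a))%:R * minval (root_val R p m v) z| <= B.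
  by move=> Uv; apply: (root_minval_bound _ U_good).
(* Since [phi t] and [phi a] commute, local heights defined with [a] scale correctly under
   [phi t]. *)
have comm z : addpoly p e.+1 (twdeg (phi t)) (fun l => frob (twcoef (phi t) l)) (Phi z)
    = Phi (addpoly p e.+1 (twdeg (phi t)) (fun l => frob (twcoef (phi t) l)) z).
  rewrite -!(tweval_addpoly p e.+1 frob) /Phi.
  transitivity (tweval q frob (phi (t * a)) z).
    by rewrite rmorphM (twevalM charK tauE frobD frobM).
  by rewrite mulrC rmorphM (twevalM charK tauE frobD frobM).
have lead0m : frob (twcoef (phi t) (twdeg (phi t))) != 0 by rewrite expf_neq0.
have U_val v : U v -> is_valuation v by case: U_good => h _ _ _; apply: h.
have NP v : U v -> real_valuation (root_val R p m v).
  by move=> Uv; apply: root_val_real_valuation => //; apply: U_val.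
have [||||T [Tfin TU ltC]] := HC m c
  (fun v => lheight (root_val R p m v) Phi (q ^ twdeg (phi a))%N).
- exact: (pfree_orbit charK tauE t_gt0 frob_ntors).
- by move=> v z /bound [B hB]; apply: lheight_ge0 D_gt1 hB z.
- move=> v k Uv; have [B hB] := bound v Uv.
  exact: (lheight_iter_addpoly (A := fun l => frob (twcoef (phi t) l)) (NP v Uv)
    D_gt1 hB charK (ltn0Sn e) lead0m comm).
- move=> v z Uv z0; have [B hB] := bound v Uv.
  have := lheight_escape (A := fun l => frob (twcoef (phi t) l)) (NP v Uv)
    D_gt1 hB charK (ltn0Sn e) t_gt0 lead0m comm z0.
  by rewrite (place_radiusE e.+1 charK U_good lead0 m Uv)
    (place_shiftE e.+1 charK U_good lead0 m Uv).
apply: lt_le_trans ltC _.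
exact: (height_ge p_gt0 U_good U_coherent charK (ltn0Sn e) tauE a_gt0 yc y0 Tfin TU).
Qed.
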